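(* Let $0<\lambda<1$ be arbitrary. If $V=\sqrt{T}$ and $\alpha=T$ in Algorithm 1 (defined in the context), then for all $T\ge1$ and all $k\in\{1,2,\ldots,m\}$, we have $$\Pr\Big(\sum_{t=1}^{T} g_k^t(\mathbf{x}(t))\le O\big(\sqrt{T}\log(T)\log(\tfrac1\lambda)\big)\Big)\ge 1-\lambda .$$
   Context: Setting. $\mathcal{X}_0\subset\mathbb{R}^n$ is a known fixed compact convex set. $\omega$ is a random variable with values in $\Omega$ and unknown distribution, and $\omega(1),\omega(2),\ldots$ are i.i.d. samples of $\omega$. For $k\in\{1,\ldots,m\}$, $g_k(\mathbf{x};\omega)$ is convex in $\mathbf{x}\in\mathcal{X}_0$ for each $\omega\in\Omega$. Write $g_k^t(\mathbf{x})=g_k(\mathbf{x};\omega(t))$, $\mathbf{g}(\mathbf{x};\omega)=[g_1(\mathbf{x};\omega),\ldots,g_m(\mathbf{x};\omega)]^{\mathsf T}$, $\mathbf{g}^t(\mathbf{x})=\mathbf{g}(\mathbf{x};\omega(t))$, $\tilde g_k(\mathbf{x})=\mathbb{E}_\omega[g_k(\mathbf{x};\omega)]$. The loss functions $f^t$, $t=1,2,\ldots$, are convex on $\mathcal{X}_0$ and may vary arbitrarily, as long as each $f^t$ is independent of all $\omega(\tau)$ with $\tau\ge t+1$ (for example $f^t$ may be chosen adversarially based on $\omega(1),\ldots,\omega(t)$ and $\mathbf{x}(1),\ldots,\mathbf{x}(t)$). With $\mathcal{W}(0)=\{\emptyset,\Omega\}$ the trivial $\sigma$-algebra and $\mathcal{W}(t)=\sigma(\omega(1),\ldots,\omega(t))$,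 the quantities $\mathbf{x}(t)$ and $\mathbf{Q}(t)$ below are $\mathcal{W}(t-1)$-measurable for all $t\ge1$. $\|\cdot\|$ is the Euclidean norm. $\nabla h(\mathbf{x})$ denotes a subgradient of the convex function $h$ at $\mathbf{x}$, i.e. $h(\mathbf{y})\ge h(\mathbf{x})+[\nabla h(\mathbf{x})]^{\mathsf T}[\mathbf{y}-\mathbf{x}]$ for all $\mathbf{y}\in\mathcal{X}_0$. Assumption (basic). There are constants $D_1,D_2,G,R>0$ such that $\|\nabla f^t(\mathbf{x})\|\le D_1$, $\|\nabla g_k(\mathbf{x};\omega)\|\le D_2$, $\|\mathbf{g}(\mathbf{x};\omega)\|\le G$ and $\|\mathbf{x}-\mathbf{y}\|\le R$ for all $\mathbf{x},\mathbf{y}\in\mathcal{X}_0$, all $t$, all $\omega\in\Omega$ and all $k$. Assumption (Slater). There are $\epsilon>0$ and $\hat{\mathbf{x}}\in\mathcal{X}_0$ with $\tilde g_k(\hat{\mathbf{x}})\le-\epsilon$ for all $k\in\{1,\ldots,m\}$. Algorithm 1. $V,\alpha$ are constant algorithm parameters. Choose $\mathbf{x}(1)\in\mathcal{X}_0$ arbitrarily and set $Q_k(1)=0$ for all $k$. At the end of each round $t\in\{1,2,\ldots\}$, observe $f^t,\mathbf{g}^t$ and: (i) let $\mathbf{x}(t+1)$ be the minimizer over $\mathbf{x}\in\mathcal{X}_0$ of $V[\nabla f^t(\mathbf{x}(t))]^{\mathsf T}[\mathbf{x}-\mathbf{x}(t)]+\sum_{k=1}^m Q_k(t)[\nabla g_k^t(\mathbf{x}(t))]^{\mathsf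 T}[\mathbf{x}-\mathbf{x}(t)]+\alpha\|\mathbf{x}-\mathbf{x}(t)\|^2$; (ii) set $Q_k(t+1)=\max\{Q_k(t)+g_k^t(\mathbf{x}(t))+[\nabla g_k^t(\mathbf{x}(t))]^{\mathsf T}[\mathbf{x}(t+1)-\mathbf{x}(t)],0\}$ for each $k$. Write $\mathbf{Q}(t)=[Q_1(t),\ldots,Q_m(t)]^{\mathsf T}$. *)

(* Defs.v *)
From HB Require Import structures.
From mathcomp Require Export all_boot all_order all_algebra.
From mathcomp Require Export all_classical all_reals all_analysis.

Set Implicit Arguments.
Unset Strict Implicit.
Unset Printing Implicit Defensive.

Import Order.TTheory GRing.Theory Num.Theory.
Import numFieldNormedType.Exports.

Local Open Scope classical_set_scope.
Local Open Scope ring_scope.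

Section Euclidean.
Context {R : realType}.

Definition dotv n (u v : 'rV[R]_n) : R := \sum_(i < n) u 0 i * v 0 i.

(* The library norm `|v| on 'rV[R]_n is the sup norm, hence this definition. *)
Definition enorm n (v : 'rV[R]_n) : R := Num.sqrt (dotv v v).

Definition subgradient n (X0 : set 'rV[R]_n) (h : 'rV[R]_n -> R)
    (x v : 'rV[R]_n) : Prop :=
  forall y, X0 y -> h x + dotv v (y - x) <= h y.

Definition minimizer n (X0 : set 'rV[R]_n) (h : 'rV[R]_n -> R)
    (z : 'rV[R]_n) : Prop :=
  X0 z /\ forall y, X0 y -> h z <= h y.

End Euclidean.

Section Randomness.
Context {d : measure_display} {T : measurableType d} {R : realType}.

(* sigma(X_i ; i in D) *)
Definition sigma_of d' (S : measurableType d') (I : Type) (D : set I)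
    (X : I -> T -> S) : set (set T) :=
  <<s \bigcup_(i in D) preimage_set_system setT (X i) measurable >>.

Definition sigma_independent (P : probability T R) (F H : set (set T)) : Prop :=
  forall A B, F A -> H B -> P (A `&` B) = (P A * P B)%E.

Definition mutually_independent (P : probability T R) d'
    (S : measurableType d') (D : set nat) (X : nat -> T -> S) : Prop :=
  forall (J : seq nat) (A : nat -> set S),
    uniq J -> (forall j, j \in J -> D j) -> (forall j, measurable (A j)) ->
    P (\big[setI/setT]_(j <- J) (X j @^-1` A j))
      = (\prod_(j <- J) P (X j @^-1` A j))%E.

(* Times are 1, 2, 3, ...; index 0 of a time-indexed family is never used. *)
Definition iid_samples (P : probability T R) d' (Om : measurableType d')
    (mu : probability Om R) (om : nat -> {RV P >-> Om}) : Prop :=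
  mutually_independent P [set t | (1 <= t)%N] om /\
  (forall t, (1 <= t)%N -> forall A, measurable A ->
     distribution P (om t) A = mu A).

(* W(t) = sigma(om(1), ..., om(t)) and sigma(om(tau) ; tau >= t + 1) *)
Definition history d' (Om : measurableType d') (om : nat -> T -> Om) (t : nat) :=
  sigma_of [set s | (1 <= s <= t)%N] om.

Definition future d' (Om : measurableType d') (om : nat -> T -> Om) (t : nat) :=
  sigma_of [set s | (t < s)%N] om.

Definition measurable_wrt (F : set (set T)) p (X : T -> 'rV[R]_p) : Prop :=
  forall (i : 'I_p) (A : set R), measurable A -> F ((fun w => X w 0 i) @^-1` A).

End Randomness.

Section Model.
Context {R : realType} (n m : nat).
Variable X0 : set 'rV[R]_n.

(* gradg k x w and gradf t w x stand for the chosen subgradients of g_k(.; w)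
   and f^t at x.  They are selections: at boundary points of X0 the set of all
   subgradients relative to X0 is unbounded, so the norm bounds below can only
   concern the selected ones. *)
Record constraint_functions d' (Om : measurableType d')
    (g : 'I_m -> 'rV[R]_n -> Om -> R)
    (gradg : 'I_m -> 'rV[R]_n -> Om -> 'rV[R]_n) : Prop := {
  constraint_measurable : forall k x, X0 x -> measurable_fun setT (g k x) ;
  constraint_convex : forall k w, convex_function X0 (fun x => g k x w) ;
  constraint_subgradient : forall k w x, X0 x ->
    subgradient X0 (fun y => g k y w) x (gradg k x w) }.

Record loss_functions d (T : measurableType d) (P : probability T R)
    d' (Om : measurableType d') (om : nat -> T -> Om)
    (f : nat -> T -> 'rV[R]_n -> R)
    (gradf : nat -> T -> 'rV[R]_n -> 'rV[R]_n) : Prop := {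
  loss_measurable : forall t, (1 <= t)%N -> forall x, X0 x ->
    measurable_fun setT (fun w => f t w x) ;
  loss_convex : forall t, (1 <= t)%N -> forall w, convex_function X0 (f t w) ;
  loss_subgradient : forall t, (1 <= t)%N -> forall w x, X0 x ->
    subgradient X0 (f t w) x (gradf t w x) ;
  loss_independent_future : forall t, (1 <= t)%N ->
    sigma_independent P (sigma_of X0 (fun x w => f t w x)) (future om t) }.

Record basic_assumption (D1 D2 G Rad : R) (T Om : Type)
    (g : 'I_m -> 'rV[R]_n -> Om -> R)
    (gradg : 'I_m -> 'rV[R]_n -> Om -> 'rV[R]_n)
    (gradf : nat -> T -> 'rV[R]_n -> 'rV[R]_n) : Prop := {
  gradf_bound : forall t, (1 <= t)%N -> forall w x, X0 x ->
    enorm (gradf t w x) <= D1 ;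
  gradg_bound : forall k w x, X0 x -> enorm (gradg k x w) <= D2 ;
  g_bound : forall w x, X0 x -> enorm (\row_k g k x w) <= G ;
  diameter_bound : forall x y, X0 x -> X0 y -> enorm (x - y) <= Rad }.

Definition slater_assumption (eps : R) d' (Om : measurableType d')
    (mu : probability Om R) (g : 'I_m -> 'rV[R]_n -> Om -> R) : Prop :=
  exists2 xhat, X0 xhat & forall k, ('E_mu[g k xhat] <= (- eps)%:E)%E.

(* One sample path: here gt t k = g_k^t, gradgt t k its subgradient selection,
   and gradft t that of f^t. *)
Record algorithm1 (V alpha : R)
    (gt : nat -> 'I_m -> 'rV[R]_n -> R)
    (gradgt : nat -> 'I_m -> 'rV[R]_n -> 'rV[R]_n)
    (gradft : nat -> 'rV[R]_n -> 'rV[R]_n)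
    (x : nat -> 'rV[R]_n) (Q : nat -> 'rV[R]_m) : Prop := {
  alg_x1 : X0 (x 1%N) ;
  alg_Q1 : forall k, Q 1%N 0 k = 0 ;
  alg_x : forall t, (1 <= t)%N ->
    minimizer X0 (fun y => V * dotv (gradft t (x t)) (y - x t)
                           + \sum_(k < m) Q t 0 k
                               * dotv (gradgt t k (x t)) (y - x t)
                           + alpha * enorm (y - x t) ^+ 2) (x t.+1) ;
  alg_Q : forall t, (1 <= t)%N -> forall k,
    Q t.+1 0 k = Num.max (Q t 0 k + gt t k (x t)
                          + dotv (gradgt t k (x t)) (x t.+1 - x t)) 0 }.

End Model.

(* B(T, lambda) = O(h(T, lambda)), for a comparison function h that vanishes at
   T = 1 and as lambda -> 1: the constant C is uniform in T >= 2 and in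
   0 < lambda <= lambda0, for each cut-off lambda0 < 1. *)
Definition bigO_horizon_confidence {R : realType} (B h : nat -> R -> R) : Prop :=
  forall lambda0 : R, 0 < lambda0 < 1 ->
    exists2 C : R, 0 < C &
      forall (T : nat) (lambda : R), (2 <= T)%N -> 0 < lambda <= lambda0 ->
        `|B T lambda| <= C * `|h T lambda|.

(* Main.v *)
From HB Require Import structures.
From mathcomp Require Import measurable_realfun zify ring lra.
Require Import Defs.

Set Implicit Arguments.
Unset Strict Implicit.
Unset Printing Implicit Defensive.

Import Order.TTheory GRing.Theory Num.Theory.
Import numFieldNormedType.Exports.

Local Open Scope classical_set_scope.
Local Open Scope ring_scope.

(** Write xh for the Slater point, q and x for the queues and the iterate at a
    given time, and put alpha = T, V = sqrt T.

    The queues dominate the violations: summing the queue recursion over time,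
    the total violation of a constraint is at most its last queue plus D2 times
    the length of the path of the iterates, and since the objective minimized at
    each step is no larger at the minimizer than at the current iterate, a step
    has length at most (V D1 + D2 (q_1 + ... + q_m)) / alpha.  Hence a bound z on
    all the queues up to time T + 1 gives a violation of at most
    z + D2 (sqrt T D1 + m D2 z) ([constraint_sum_le_potential]), and it suffices
    to show that the queues are O(sqrt T + log T + log (1 / lambda)) with
    probability 1 - lambda.

    The potential Z = sqrt (|q|^2 + 2 alpha |xh - x|^2) dominates the queues.  The
    strong convexity of the proximal step turns into a telescoping term exactly
    the quantity alpha |xh - x|^2, so including it in the potential yields a
    one-slot inequality ([queue_potential_step])
        Z(t+1)^2 <= Z(t)^2 + 2 K + 2 (q_1 g_1(xh) + ... + q_m g_m(xh)),
    K = O(sqrt T), in which the fresh sample enters only through the values of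
    the constraints at the fixed point xh.  This sample is independent of the
    past, hence of q, and the expectations of these values are at most - eps.  Since
    q_1 + ... + q_m >= Z - O(sqrt T), the potential has a negative drift of order
    eps as soon as it exceeds a threshold theta = O(sqrt T).  Dividing by
    M = max (Z, theta) gives Z(t+1) <= M(t) + D with D = (K + sum q_k g_k(xh)) / M,
    whose absolute value is at most a constant that does not depend on T.  With
    exp y <= 1 + y + 2 y^2 for small y, this makes
    E exp (r M) contract at each slot up to an additive multiple of
    exp (r theta), for a constant rate r ([exp_potential_drift]); it is therefore
    bounded by a constant times exp (r theta) for all times
    ([exp_moment_le]).

    Markov's inequality for the sum over t <= T + 1 of exp (r M(t)) bounds all the
    potentials simultaneously by
    theta + log (C (T + 1) / lambda) / r ([constraint_violation_whp]), and this is
    O(sqrt T log T log (1 / lambda)) for T >= 2 and lambda away from 1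
    ([violation_bound_bigO]).

    Two measure-theoretic points need care.  The product rule for the expectation
    of a function of the past times a function of the current sample comes from
    the pi-lambda theorem and Tonelli's theorem ([Rintegral_mul_history]).  The
    violation is a measurable function although g_k is only assumed measurable
    at each fixed point, because g_k is Lipschitz in the point
    ([measurable_caratheodory]). *)

(** * Integrals over a probability space *)

Lemma bounded_integrable d (S : measurableType d) (R : realType)
    (P : probability S R) (f : S -> R) (M : R) :
  measurable_fun setT f -> (forall w, `|f w| <= M) ->
  P.-integrable setT (EFin \o f).
Proof.
move=> mf fM; apply: measurable_bounded_integrable => //.
  by rewrite (le_lt_trans (probability_le1 _ _))// ltry.
exists M; split; first by rewrite num_real.
by move=> x Mx w _ /=; rewrite (le_trans (fM w))// ltW.
Qed.

Lemma Rintegral_probability_cst d (S : measurableType d) (R : realType)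
    (P : probability S R) (c : R) :
  \int[P]_w c = c.
Proof.
rewrite Rintegral_cst// [X in fine X](_ : _ = 1%E) ?mulr1//.
exact: probability_setT.
Qed.

Lemma integrable_Rsum d (S : measurableType d) (R : realType)
    (mu : {measure set S -> \bar R}) (I : Type) (s : seq I) (h : I -> S -> R) :
  (forall i, mu.-integrable setT (EFin \o h i)) ->
  mu.-integrable setT (EFin \o (fun w => \sum_(i <- s) h i w)).
Proof.
move=> ih.
have := @integrable_sum _ _ _ mu setT measurableT I s xpredT _ (fun i _ => ih i).
by apply: eq_integrable => // w _; rewrite /= sumEFin.
Qed.

Lemma Rintegral_sum d (S : measurableType d) (R : realType)
    (mu : {measure set S -> \bar R}) (I : Type) (s : seq I) (h : I -> S -> R) :
  (forall i, mu.-integrable setT (EFin \o h i)) ->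
  \int[mu]_w (\sum_(i <- s) h i w) = \sum_(i <- s) \int[mu]_w h i w.
Proof.
move=> ih; elim: s => [|i s IH].
  under eq_Rintegral do rewrite big_nil.
  by rewrite Rintegral_cst// mul0r big_nil.
under eq_Rintegral do rewrite big_cons.
by rewrite RintegralD ?IH ?big_cons//; exact: integrable_Rsum.
Qed.

(** Markov's inequality in the form needed for a high-probability bound: the
    complementary event is what gets bounded from below. *)
Lemma markov_complement d (S : measurableType d) (R : realType)
    (P : probability S R) (X : S -> R) (a c lambda : R) (A : set S) :
  measurable_fun setT X -> (forall w, 0 <= X w) -> 0 < a ->
  P.-integrable setT (EFin \o X) ->
  \int[P]_w X w <= c -> c <= lambda * a ->
  measurable A -> (forall w, X w < a -> A w) ->
  ((1 - lambda)%:E <= P A)%E.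
Proof.
move=> mX X0 a0 iX Xc ca mA XA.
pose B := [set w | a <= X w].
have mB : measurable B.
  have := measurable_fun_le measurableT (measurable_cst a) mX.
  by rewrite setTI.
have PB : (P B <= lambda%:E)%E.
  pose X' : {mfun S >-> R} := HB.pack X (isMeasurableFun.Build _ _ _ _ _ mX).
  have := @markov _ _ _ P X' id a a0 (@measurable_id _ _ _) (fun _ r0 => r0)
    (fun _ _ _ _ xy => xy).
  have -> : [set w | (a%:E <= `|(X' w)%:E|)%E] = B.
    by apply/seteqP; split => w /=; rewrite lee_fin ger0_norm.
  rewrite unlock /= => h; rewrite -(@lee_pmul2l _ a%:E) ?lte_fin//.
  apply: le_trans h _; under eq_integral do rewrite ger0_norm//.
  rewrite -[leLHS]fineK; last exact: integrable_fin_num.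
  by rewrite -EFinM lee_fin mulrC (le_trans Xc).
apply: le_trans (_ : (P (~` B) <= _)%E).
  by rewrite probability_setC// EFinB leeB.
apply: le_measure; rewrite ?inE//; first exact: measurableC.
by move=> w /= /negP; rewrite -ltNge; exact: XA.
Qed.

(** * Independence of a sample from the past *)

Section Independence.
Context {d : measure_display} {S : measurableType d} {R : realType}.
Variable P : probability S R.
Context d1 d2 (T1 : measurableType d1) (T2 : measurableType d2).
Variables (X : {mfun S >-> T1}) (Y : {mfun S >-> T2}).
Hypothesis indep : forall A B, measurable A -> measurable B ->
  P (X @^-1` A `&` Y @^-1` B) = (P (X @^-1` A) * P (Y @^-1` B))%E.

(** The joint law of X and Y agrees with the product of their laws on
    rectangles, hence everywhere; Tonelli's theorem then splits the integral. *)
Lemma ge0_integral_mul_independent (u : T1 -> R) (v : T2 -> R) :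
    measurable_fun setT u -> measurable_fun setT v ->
    (forall y, 0 <= u y) -> (forall z, 0 <= v z) ->
  (\int[P]_w (u (X w) * v (Y w))%:E
   = \int[P]_w (u (X w))%:E * \int[P]_w (v (Y w))%:E)%E.
Proof.
move=> mu mv u0 v0.
have mXY : measurable_fun setT (fun w => (X w, Y w)).
  exact: measurable_fun_pair.
pose XY : {mfun S >-> (T1 * T2)%type} :=
  HB.pack (fun w : S => (X w, Y w)) (isMeasurableFun.Build _ _ _ _ _ mXY).
pose h (z : T1 * T2) : \bar R := (u z.1 * v z.2)%:E.
have mh : measurable_fun [set: T1 * T2] h.
  apply/measurable_EFinP; apply: measurable_funM;
    apply: measurableT_comp => //; exact: measurable_fst || exact: measurable_snd.
have h0 z : (0 <= h z)%E by rewrite lee_fin mulr_ge0.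
have mEu : measurable_fun setT (EFin \o u) by exact/measurable_EFinP.
have mEv : measurable_fun setT (EFin \o v) by exact/measurable_EFinP.
transitivity (\int[distribution P XY]_z h z)%E.
  by rewrite ge0_integral_distribution.
have jointE : forall E, measurable E ->
    (distribution P X \x distribution P Y)%E E = distribution P XY E.
  apply: product_measure_unique => A B mA mB.
  by rewrite /distribution /pushforward /= -indep.
rewrite (@eq_measure_integral _ _ _ setT
  (distribution P X \x distribution P Y)%E); last first.
  by move=> A mA _; exact/esym/jointE.
rewrite fubini_tonelli1//.
have intX : (\int[distribution P X]_y (u y)%:E = \int[P]_w (u (X w))%:E)%E.
  exact: (ge0_integral_distribution (X : {RV P >-> T1}) mEu).
have intY : (\int[distribution P Y]_z (v z)%:E = \int[P]_w (v (Y w))%:E)%E.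
  exact: (ge0_integral_distribution (Y : {RV P >-> T2}) mEv).
have -> : fubini_F (distribution P Y) h =
    (fun x => ((u x)%:E * \int[P]_w (v (Y w))%:E)%E).
  apply/funext => x; rewrite /fubini_F /h /=.
  under eq_integral do rewrite EFinM.
  rewrite ge0_integralZl ?lee_fin//; last by move=> z _; rewrite lee_fin.
  by congr (_ * _)%E; exact: intY.
rewrite ge0_integralZr//.
- by congr (_ * _)%E; exact: intX.
- by move=> y _; rewrite lee_fin.
- by apply: integral_ge0 => w _; rewrite lee_fin.
Qed.

(** Shifting v by its bound makes it nonnegative, and the contribution of the
    shift cancels on both sides because every integral is finite. *)
Lemma Rintegral_mul_independent (u : T1 -> R) (v : T2 -> R) (a b : R) :
    measurable_fun setT u -> measurable_fun setT v ->
    (forall y, 0 <= u y <= a) -> (forall z, `|v z| <= b) ->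
  \int[P]_w (u (X w) * v (Y w)) = (\int[P]_w u (X w)) * (\int[P]_w v (Y w)).
Proof.
move=> mu mv ua vb.
have u0 y : 0 <= u y by case/andP: (ua y).
have un y : `|u y| <= a by rewrite ger0_norm//; case/andP: (ua y).
have a0 : 0 <= a by exact: le_trans (un point).
have b0 : 0 <= b by exact: le_trans (vb point).
have v0 z : 0 <= v z + b by have := vb z; rewrite ler_norml; lra.
have muX : measurable_fun setT (u \o X) by exact: measurableT_comp.
have mvY : measurable_fun setT (v \o Y) by exact: measurableT_comp.
have iX : P.-integrable setT (EFin \o (u \o X)).
  by apply: (@bounded_integrable _ _ _ _ _ a) => // w; exact: un.
have iY : P.-integrable setT (EFin \o (v \o Y)).
  by apply: (@bounded_integrable _ _ _ _ _ b) => // w; exact: vb.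
have ib : P.-integrable setT (EFin \o cst b).
  by apply: (@bounded_integrable _ _ _ _ _ b) => // w; rewrite ger0_norm.
have mvb : measurable_fun setT (fun z => v z + b) by exact: measurable_funD.
have iYb : P.-integrable setT (EFin \o (fun w => v (Y w) + b)).
  exact: (integrableD _ iY ib).
have : \int[P]_w (u (X w) * (v (Y w) + b)) =
    (\int[P]_w u (X w)) * \int[P]_w (v (Y w) + b).
  rewrite /Rintegral (@ge0_integral_mul_independent u (fun z => v z + b))//.
  by rewrite fineM//; exact: integrable_fin_num.
have iXY : P.-integrable setT (EFin \o (fun w => u (X w) * v (Y w))).
  apply: (@bounded_integrable _ _ _ _ _ (a * b)).
    by apply: measurable_funM.
  by move=> w; rewrite normrM ler_pM.
have iXb : P.-integrable setT (EFin \o (fun w => u (X w) * b)).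
  apply: (@bounded_integrable _ _ _ _ _ (a * b)).
    by apply: measurable_funM.
  by move=> w; rewrite normrM (ger0_norm b0) ler_wpM2r.
under eq_Rintegral do rewrite mulrDr.
rewrite (RintegralD measurableT iXY iXb) (RintegralD measurableT iY ib).
rewrite (RintegralZr b measurableT iX).
rewrite Rintegral_probability_cst.
by rewrite mulrDr => /addIr.
Qed.

End Independence.

Section History.
Context {d : measure_display} {S : measurableType d} {R : realType}.
Variable P : probability S R.
Context d' (Om : measurableType d').
Variable om : nat -> {RV P >-> Om}.

(** The sigma-algebra of the past, as the measurable structure of a copy of the
    sample space, so that the closure properties of measurable functions apply to
    functions of the past.  Its generator is spelled as in the definition of
    [history], which makes the two sigma-algebras convertible. *)
Definition history_gen (t : nat) : set (set S) :=
  \bigcup_(i in [set s | (1 <= s <= t)%N]) preimage_set_system setT (om i) measurable.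

Definition history_type (t : nat) := g_sigma_algebraType (history_gen t).

Lemma history_measurable t (A : set S) : history om t A -> measurable A.
Proof.
apply: smallest_sub; first exact: sigma_algebra_measurable.
move=> B [i _ [C mC <-]]; rewrite setTI -[X in measurable X]setTI.
exact: measurable_funPT.
Qed.

Lemma measurable_from_history t (f : S -> R) :
  measurable_fun setT (f : history_type t -> R) -> measurable_fun setT f.
Proof.
move=> mf _ A mA; apply: (@history_measurable t).
exact: mf.
Qed.

(** Mutual independence gives the product rule on the finite intersections of
    events about the samples 1, ..., t - 1.  They form a pi-system that generates
    the past, and the events satisfying the rule form a Dynkin system. *)
Lemma history_independent t (A : set S) (B : set Om) :
  mutually_independent P [set t | (1 <= t)%N] om -> (1 <= t)%N ->
  history om t.-1 A -> measurable B ->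
  P (A `&` om t @^-1` B) = (P A * P (om t @^-1` B))%E.
Proof.
move=> ind t1 hA mB.
have mtB : measurable (om t @^-1` B).
  by rewrite -[X in measurable X]setTI; exact: measurable_funPT.
pose G : set (set S) := [set A | exists C : nat -> set Om,
  (forall i, measurable (C i)) /\
  A = \big[setI/setT]_(j <- index_iota 1 t) (om j @^-1` C j)].
have mG A' : G A' -> measurable A'.
  move=> [C [mC ->]]; apply: big_rec => // i E _ mE.
  apply: measurableI => //.
  by rewrite -[X in measurable X]setTI; exact: measurable_funPT.
have GI : setI_closed G.
  move=> _ _ [C1 [mC1 ->]] [C2 [mC2 ->]]; exists (fun i => C1 i `&` C2 i).
  split; first by move=> i; exact: measurableI.
  by rewrite -big_split.
pose L : set (set S) := [set A | measurable A /\
   P (A `&` om t @^-1` B) = (P A * P (om t @^-1` B))%E].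
suff: L A by case.
have dynL : dynkin L.
  split.
  - by split => //; rewrite setTI probability_setT mul1e.
  - move=> E [mE PE]; split; first exact: measurableC.
    have -> : P (~` E `&` om t @^-1` B)
        = (P (om t @^-1` B) - P (E `&` om t @^-1` B))%E.
      rewrite setIC -setDE (setIC E) measureD//.
      by rewrite (le_lt_trans (probability_le1 _ _))// ltry.
    rewrite PE probability_setC// muleBl//.
    + by rewrite mul1e.
    + by rewrite fin_num_measure.
  - move=> F tF LF; have mF n : measurable (F n) by have [] := LF n.
    split; first exact: bigcupT_measurable.
    rewrite setI_bigcupl measure_bigcup//=; last 2 first.
    + by move=> n _; exact: measurableI.
    + exact: trivIset_setIr.
    rewrite measure_bigcup// muleC.
    rewrite -[P (om t @^-1` B)]fineK ?fin_num_measure// -nneseriesZl; last first.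
      by move=> n _; exact: measure_ge0.
    apply: eq_eseriesr => n _; have [_ ->] := LF n.
    by rewrite muleC fineK// fin_num_measure.
have gL : <<s G >> `<=` L.
  apply: lambda_system_subset => //.
  + by apply/dynkin_lambda_system.
  + move=> E GE; split; first exact: mG.
    case: GE => C [mC ->].
    (* one family of events for the samples 1, ..., t: those of E, then B *)
    pose C' j := if j == t then B else C j.
    have mC' j : measurable (C' j) by rewrite /C'; case: ifP.
    have C'lt j : (1 <= j < t)%N -> om j @^-1` C' j = om j @^-1` C j.
      by case/andP => _ jt; rewrite /C' ltn_eqF.
    have -> : \big[setI/setT]_(j <- index_iota 1 t) (om j @^-1` C j)
      = \big[setI/[set: S]]_(j <- index_iota 1 t) (om j @^-1` C' j).
      by apply: eq_big_nat => j /C'lt.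
    have C't : om t @^-1` B = om t @^-1` C' t by rewrite /C' eqxx.
    have := ind (index_iota 1 t.+1) C' (iota_uniq _ _) _ mC'.
    rewrite big_nat_recr//= big_nat_recr//= -C't => ->; last first.
      by move=> j; rewrite mem_index_iota => /andP[].
    congr (_ * _)%E; apply/esym/ind => //; first exact: iota_uniq.
    by move=> j; rewrite mem_index_iota => /andP[].
apply: gL; move: hA; apply: smallest_sub; first exact: smallest_sigma_algebra.
move=> E [i /= it [C mC <-]]; apply: sub_gen_smallest.
exists (fun j => if j == i then C else setT); split.
  by move=> j; case: ifP.
rewrite setTI (bigD1_seq i) ?iota_uniq//=; last first.
  by rewrite mem_index_iota; case/andP: it => -> /= ; rewrite -ltnS prednK.
rewrite eqxx big1 ?setIT// => j /negPf ->.
by rewrite preimage_setT.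
Qed.

Lemma Rintegral_mul_history t (mu : probability Om R) (U : S -> R) (v : Om -> R)
    (a b : R) :
  iid_samples mu om -> (1 <= t)%N ->
  measurable_fun setT (U : history_type t.-1 -> R) ->
  measurable_fun setT v ->
  (forall w, 0 <= U w <= a) -> (forall z, `|v z| <= b) ->
  \int[P]_w (U w * v (om t w)) = (\int[P]_w U w) * (\int[mu]_z v z).
Proof.
move=> [ind law] t1 mU mv Ua vb.
have mid : measurable_fun setT (id : S -> history_type t.-1).
  by move=> _ A mA; rewrite setTI; exact: (@history_measurable t.-1).
pose past : {mfun S >-> history_type t.-1} :=
  HB.pack (id : S -> history_type t.-1) (isMeasurableFun.Build _ _ _ _ _ mid).
have indep A B : measurable A -> measurable B ->
    P (past @^-1` A `&` om t @^-1` B)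
    = (P (past @^-1` A) * P (om t @^-1` B))%E.
  by move=> mA mB; exact: history_independent.
rewrite (Rintegral_mul_independent indep mU mv Ua vb); congr (_ * fine _).
have mEv : measurable_fun setT (EFin \o v) by exact/measurable_EFinP.
have iv : P.-integrable setT ((EFin \o v) \o om t).
  apply: (@bounded_integrable _ _ _ _ (v \o om t) b) => [|w]; last exact: vb.
  exact: measurableT_comp.
rewrite -(integral_distribution mEv iv).
by apply: eq_measure_integral => A mA _; exact: law.
Qed.

End History.

(** * Euclidean geometry *)

Section DotProduct.
Context {R : realType} (n : nat).
Implicit Types (u v w : 'rV[R]_n) (a : R).

Lemma dotvC u v : dotv u v = dotv v u.
Proof. by apply: eq_bigr => i _; rewrite mulrC. Qed.

Lemma dotvDl u v w : dotv (u + v) w = dotv u w + dotv v w.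
Proof. by rewrite -big_split; apply: eq_bigr => i _; rewrite mxE mulrDl. Qed.

Lemma dotvZl a u v : dotv (a *: u) v = a * dotv u v.
Proof. by rewrite mulr_sumr; apply: eq_bigr => i _; rewrite mxE mulrA. Qed.

Lemma dotvDr u v w : dotv w (u + v) = dotv w u + dotv w v.
Proof. by rewrite dotvC dotvDl !(dotvC w). Qed.

Lemma dotvZr a u v : dotv u (a *: v) = a * dotv u v.
Proof. by rewrite dotvC dotvZl dotvC. Qed.

Lemma dotvNl u v : dotv (- u) v = - dotv u v.
Proof. by rewrite -scaleN1r dotvZl mulN1r. Qed.

Lemma dotvNr u v : dotv u (- v) = - dotv u v.
Proof. by rewrite dotvC dotvNl dotvC. Qed.

Lemma dotv_ge0 u : 0 <= dotv u u.
Proof. by apply: sumr_ge0 => i _; rewrite -expr2 sqr_ge0. Qed.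

Lemma enorm_ge0 u : 0 <= enorm u.
Proof. exact: sqrtr_ge0. Qed.

Lemma sqr_enorm u : enorm u ^+ 2 = dotv u u.
Proof. by rewrite sqr_sqrtr// dotv_ge0. Qed.

Lemma enormN u : enorm (- u) = enorm u.
Proof. by rewrite /enorm dotvNl dotvNr opprK. Qed.

Lemma dotv0 u : dotv u 0 = 0.
Proof. by apply: big1 => i _; rewrite mxE mulr0. Qed.

Lemma enorm0 : enorm (0 : 'rV[R]_n) = 0.
Proof. by rewrite /enorm dotv0 sqrtr0. Qed.

Lemma enorm_eq0 u : (enorm u == 0) = (u == 0).
Proof.
apply/eqP/eqP => [u0|->]; last exact: enorm0.
have /eqP : \sum_(i < n) u 0 i * u 0 i = 0 by rewrite -/(dotv u u) -sqr_enorm u0 expr0n.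
rewrite psumr_eq0; last by move=> i _; rewrite -expr2 sqr_ge0.
move=> /allP ui; apply/rowP => i; rewrite mxE.
by have := ui i (mem_index_enum _); rewrite /= mulf_eq0 orbb => /eqP.
Qed.

Lemma coord_le_enorm u i : `|u 0 i| <= enorm u.
Proof.
rewrite -(@ler_pXn2r _ 2)// ?nnegrE ?enorm_ge0// sqr_enorm real_normK ?num_real//.
rewrite /dotv (bigD1 i)//= -expr2 lerDl; apply: sumr_ge0 => j _.
by rewrite -expr2 sqr_ge0.
Qed.

(** Cauchy-Schwarz, from the nonnegativity of the squared norm of
    |v| u - |u| v. *)
Lemma dotv_le_enorm u v : dotv u v <= enorm u * enorm v.
Proof.
have [/eqP|u0] := eqVneq (enorm u) 0.
  by rewrite enorm_eq0 => /eqP->; rewrite dotvC dotv0 enorm0 mul0r.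
have [/eqP|v0] := eqVneq (enorm v) 0.
  by rewrite enorm_eq0 => /eqP->; rewrite dotv0 enorm0 mulr0.
set a := enorm u; set b := enorm v.
have a0 : 0 < a by rewrite lt0r u0 enorm_ge0.
have b0 : 0 < b by rewrite lt0r v0 enorm_ge0.
have := dotv_ge0 (b *: u - a *: v).
rewrite !(dotvDl, dotvDr, dotvNl, dotvNr, dotvZl, dotvZr) (dotvC v u).
rewrite -!sqr_enorm -/a -/b => h.
have : 0 <= 2 * (a * b) * (a * b - dotv u v) by nra.
by rewrite pmulr_rge0 ?mulr_gt0// subr_ge0.
Qed.

Lemma normr_dotv_le u v : `|dotv u v| <= enorm u * enorm v.
Proof.
rewrite ler_norml dotv_le_enorm andbT lerNl -dotvNl -(enormN u).
exact: dotv_le_enorm.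
Qed.

Lemma sqr_enorm_conv a u v :
  enorm (a *: u + (1 - a) *: v) ^+ 2
  = a * enorm u ^+ 2 + (1 - a) * enorm v ^+ 2 - a * (1 - a) * enorm (u - v) ^+ 2.
Proof.
rewrite !sqr_enorm !(dotvDl, dotvDr, dotvNl, dotvNr, dotvZl, dotvZr) (dotvC v u).
ring.
Qed.

End DotProduct.

Lemma dotv_suml (R : realType) (n : nat) (I : Type) (r : seq I)
    (u : I -> 'rV[R]_n) (v : 'rV[R]_n) :
  dotv (\sum_(k <- r) u k) v = \sum_(k <- r) dotv (u k) v.
Proof.
elim/big_rec2: _ => [|k y z _ <-]; first by rewrite dotvC dotv0.
by rewrite dotvDl.
Qed.

(** A minimizer of a linear function plus alpha |y - x|^2 beats every other point
    y by alpha |y - z|^2: compare z with z + s (y - z), where the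
    quadratic term saves alpha s (1 - s) |y - z|^2, divide by s and let s tend
    to 0. *)
Lemma proximal_minimizer (R : realType) (n : nat) (X0 : set 'rV[R]_n)
    (c x z y : 'rV[R]_n) (alpha : R) :
  convex_set X0 -> 0 <= alpha ->
  minimizer X0 (fun y => dotv c (y - x) + alpha * enorm (y - x) ^+ 2) z ->
  X0 y ->
  dotv c (z - x) + alpha * enorm (z - x) ^+ 2 + alpha * enorm (y - z) ^+ 2
  <= dotv c (y - x) + alpha * enorm (y - x) ^+ 2.
Proof.
move=> cX a0 [Xz zmin] Xy; set D := enorm (y - z) ^+ 2.
set Fz := dotv c (z - x) + _; set Fy := dotv c (y - x) + _.
have D0 : 0 <= alpha * D by rewrite mulr_ge0// sqr_ge0.
have key (s : R) : 0 < s -> s <= 1 -> Fz + alpha * (1 - s) * D <= Fy.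
  move=> s0 s1.
  have : X0 (s *: y + (1 - s) *: z).
    by have := cX y z (Itv01 (ltW s0) s1); rewrite !inE => /(_ Xy Xz).
  move=> /zmin.
  have -> : s *: y + (1 - s) *: z - x = s *: (y - x) + (1 - s) *: (z - x).
    by rewrite !scalerBr addrACA -opprD -scalerDl (addrC s) subrK scale1r.
  rewrite sqr_enorm_conv (dotvDr (s *: _)) !dotvZr.
  have -> : y - x - (z - x) = y - z by rewrite opprB addrA subrK.
  rewrite -/D => h.
  have : s * (Fz + alpha * (1 - s) * D) <= s * Fy.
    by move: h; rewrite /Fz /Fy; lra.
  by rewrite ler_pM2l.
rewrite -[_ + alpha * D]/(Fz + alpha * D) leNgt; apply/negP => lt.
(* s = e / (2 (e + alpha D)) is at most 1 and makes alpha D s smaller than e *)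
set e := Fz + alpha * D - Fy; have e0 : 0 < e by rewrite subr_gt0.
have ed : 0 < e + alpha * D by rewrite ltr_pwDl.
have := key (e / (2 * (e + alpha * D))).
have -> : e / (2 * (e + alpha * D)) <= 1.
  by rewrite ler_pdivrMr ?mulr_gt0//; lra.
rewrite divr_gt0 ?mulr_gt0// => /(_ isT isT).
set s := e / _ => h.
have sE : s * (2 * (e + alpha * D)) = e by rewrite /s divfK// mulf_neq0// gt_eqF.
have : e <= alpha * D * s by rewrite /e; lra.
have s0 : 0 < s by rewrite divr_gt0 ?mulr_gt0.
nra.
Qed.

(** * Deterministic analysis of a sample path *)

Section SamplePath.
Context {R : realType} {n m : nat}.
Variables (X0 : set 'rV[R]_n) (D1 D2 G Rad V alpha : R).
Variables (gt : nat -> 'I_m -> 'rV[R]_n -> R)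
  (gradgt : nat -> 'I_m -> 'rV[R]_n -> 'rV[R]_n)
  (gradft : nat -> 'rV[R]_n -> 'rV[R]_n)
  (x : nat -> 'rV[R]_n) (Q : nat -> 'rV[R]_m).
Hypothesis alg : algorithm1 X0 V alpha gt gradgt gradft x Q.
Hypotheses (X0_convex : convex_set X0) (V0 : 0 <= V) (alpha0 : 0 < alpha).
Hypotheses (D20 : 0 <= D2) (G0 : 0 <= G) (Rad0 : 0 <= Rad).
Hypothesis gradft_le : forall t, (1 <= t)%N -> forall y, X0 y ->
  enorm (gradft t y) <= D1.
Hypothesis gradgt_le : forall t k y, X0 y -> enorm (gradgt t k y) <= D2.
Hypothesis gt_vec_le : forall t y, X0 y -> enorm (\row_k gt t k y) <= G.
Hypothesis X0_diam : forall y z, X0 y -> X0 z -> enorm (y - z) <= Rad.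
Hypothesis gradgt_subgradient : forall t k y, X0 y ->
  subgradient X0 (gt t k) y (gradgt t k y).

Lemma gt_le t k y : X0 y -> `|gt t k y| <= G.
Proof.
move=> Xy; apply: le_trans (gt_vec_le t Xy).
by have := coord_le_enorm (\row_k gt t k y) k; rewrite mxE.
Qed.

Lemma iterate_in t : (1 <= t)%N -> X0 (x t).
Proof.
case: t => // -[_|t _]; first exact: alg_x1 alg.
by have [] := alg_x alg (isT : (1 <= t.+1)%N).
Qed.

Lemma queue_ge0 t k : (1 <= t)%N -> 0 <= Q t 0 k.
Proof.
case: t => // -[_|t _]; first by rewrite (alg_Q1 alg).
by rewrite (alg_Q alg)// le_max lexx orbT.
Qed.

(** The objective of the algorithm is the inner product with this vector plus
    the proximal term. *)
Definition objective_gradient t :=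
  V *: gradft t (x t) + \sum_(k < m) Q t 0 k *: gradgt t k (x t).

Lemma dotv_objective_gradient t (v : 'rV[R]_n) :
  dotv (objective_gradient t) v =
  V * dotv (gradft t (x t)) v + \sum_(k < m) Q t 0 k * dotv (gradgt t k (x t)) v.
Proof.
rewrite dotvDl dotvZl dotv_suml; congr (_ + _).
by apply: eq_bigr => k _; rewrite dotvZl.
Qed.

Lemma next_iterate_minimizer t : (1 <= t)%N ->
  minimizer X0 (fun y => dotv (objective_gradient t) (y - x t)
                         + alpha * enorm (y - x t) ^+ 2) (x t.+1).
Proof.
move=> t1; have [Xx xmin] := alg_x alg t1; split => // y Xy.
by rewrite !dotv_objective_gradient; exact: xmin.
Qed.

(** The minimizer does at least as well as the current iterate, where the
    objective vanishes; so the proximal term is at most minus the linear one. *)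
Lemma iterate_step_le t : (1 <= t)%N ->
  alpha * enorm (x t.+1 - x t) <= V * D1 + D2 * \sum_(k < m) Q t 0 k.
Proof.
move=> t1; have Xx := iterate_in t1.
set s := x t.+1 - x t.
have [/eqP s0|s0] := eqVneq (enorm s) 0.
  rewrite (eqP s0) mulr0 addr_ge0// mulr_ge0//.
    by rewrite (le_trans (enorm_ge0 _) (gradft_le t1 Xx)).
  by apply: sumr_ge0 => k _; exact: queue_ge0.
have s_gt0 : 0 < enorm s by rewrite lt0r s0 enorm_ge0.
have [_ /(_ _ Xx)] := next_iterate_minimizer t1.
rewrite subrr dotv0 enorm0 expr0n mulr0 addr0 -/s dotv_objective_gradient.
move=> h; rewrite -(ler_pM2r s_gt0).
have hf : - (D1 * enorm s) <= dotv (gradft t (x t)) s.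
  have := normr_dotv_le (gradft t (x t)) s.
  rewrite ler_norml => /andP[+ _]; apply: le_trans.
  by rewrite lerN2 ler_pM2r// gradft_le.
have hg : - (D2 * (\sum_(k < m) Q t 0 k) * enorm s) <=
    \sum_(k < m) Q t 0 k * dotv (gradgt t k (x t)) s.
  rewrite mulr_sumr mulr_suml -sumrN; apply: ler_sum => k _.
  rewrite mulrAC (mulrC (_ * _)) -mulrN ler_wpM2l ?queue_ge0//.
  have := normr_dotv_le (gradgt t k (x t)) s.
  rewrite ler_norml => /andP[+ _]; apply: le_trans.
  by rewrite lerN2 ler_pM2r// gradgt_le.
have : V * - (D1 * enorm s) <= V * dotv (gradft t (x t)) s by exact: ler_wpM2l.
lra.
Qed.

(** Each queue grows by at least the linearized violation, which differs from the
    violation by at most D2 times the length of the step. *)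
Lemma constraint_sum_le T k :
  \sum_(1 <= t < T.+1) gt t k (x t)
  <= Q T.+1 0 k + D2 * \sum_(1 <= t < T.+1) enorm (x t.+1 - x t).
Proof.
elim: T => [|T IH].
  by rewrite !big_nil mulr0 addr0 queue_ge0.
rewrite !(@big_nat_recr _ _ _ T.+1)//= mulrDr.
have Xx : X0 (x T.+1) by exact: iterate_in.
have : Q T.+1 0 k + gt T.+1 k (x T.+1)
    + dotv (gradgt T.+1 k (x T.+1)) (x T.+2 - x T.+1) <= Q T.+2 0 k.
  by rewrite (alg_Q alg (isT : (1 <= T.+1)%N)) le_max lexx.
have : - (D2 * enorm (x T.+2 - x T.+1)) <=
    dotv (gradgt T.+1 k (x T.+1)) (x T.+2 - x T.+1).
  have := normr_dotv_le (gradgt T.+1 k (x T.+1)) (x T.+2 - x T.+1).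
  rewrite ler_norml => /andP[+ _]; apply: le_trans.
  by rewrite lerN2 ler_wpM2r ?enorm_ge0// gradgt_le.
lra.
Qed.

(** The distance to the reference point xh is weighted so that the proximal terms
    of successive slots telescope inside the potential. *)
Definition queue_potential (xh : 'rV[R]_n) t :=
  Num.sqrt (dotv (Q t) (Q t) + 2 * alpha * enorm (xh - x t) ^+ 2).

Lemma queue_potential_ge0 xh t : 0 <= queue_potential xh t.
Proof. exact: sqrtr_ge0. Qed.

Lemma sqr_queue_potential xh t :
  queue_potential xh t ^+ 2
  = dotv (Q t) (Q t) + 2 * alpha * enorm (xh - x t) ^+ 2.
Proof.
rewrite sqr_sqrtr// addr_ge0 ?dotv_ge0// mulr_ge0 ?sqr_ge0//.
by rewrite mulr_ge0// ltW.
Qed.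

Lemma queue_le_potential xh t : enorm (Q t) <= queue_potential xh t.
Proof.
by rewrite ler_wsqrtr// lerDl mulr_ge0 ?sqr_ge0// mulr_ge0// ltW.
Qed.

Lemma coord_queue_le_potential xh t k : Q t 0 k <= queue_potential xh t.
Proof.
apply: le_trans (queue_le_potential xh t).
exact: le_trans (ler_norm _) (coord_le_enorm _ _).
Qed.

Lemma normr_drift_le xh t : X0 xh ->
  `|\sum_(k < m) Q t 0 k * gt t k xh| <= queue_potential xh t * G.
Proof.
move=> Xh.
have -> : \sum_(k < m) Q t 0 k * gt t k xh = dotv (Q t) (\row_k gt t k xh).
  by apply: eq_bigr => k _; rewrite mxE.
rewrite (le_trans (normr_dotv_le _ _))//.
by rewrite ler_pM ?enorm_ge0 ?queue_le_potential ?gt_vec_le.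
Qed.

(** Since the distance term is bounded, a large potential comes with long queues,
    which weight the negative values of the constraints at a Slater point. *)
Lemma potential_le_queue_sum xh t : X0 xh -> (1 <= t)%N ->
  queue_potential xh t <= \sum_(k < m) Q t 0 k + 2 * Num.sqrt alpha * Rad.
Proof.
move=> Xh t1; set s := \sum_(k < m) _.
have s0 : 0 <= s by apply: sumr_ge0 => k _; exact: queue_ge0.
have c0 : 0 <= Num.sqrt alpha * Rad by rewrite mulr_ge0 ?sqrtr_ge0.
rewrite -(@ler_pXn2r _ 2)// ?nnegrE ?queue_potential_ge0//; last first.
  by rewrite addr_ge0// -mulrA mulr_ge0.
rewrite sqr_queue_potential.
have hQ : dotv (Q t) (Q t) <= s * s.
  rewrite /s mulr_suml; apply: ler_sum => k _.
  rewrite ler_wpM2l ?queue_ge0// (bigD1 k)//= lerDl.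
  by apply: sumr_ge0 => j _; exact: queue_ge0.
have hx : enorm (xh - x t) ^+ 2 <= Rad ^+ 2.
  by rewrite ler_pXn2r ?nnegrE ?enorm_ge0// X0_diam//; exact: iterate_in.
have {hx} : 2 * alpha * enorm (xh - x t) ^+ 2 <= 2 * (Num.sqrt alpha * Rad) ^+ 2.
  have -> : 2 * (Num.sqrt alpha * Rad) ^+ 2 = 2 * alpha * Rad ^+ 2.
    by rewrite exprMn (sqr_sqrtr (ltW alpha0)); ring.
  by rewrite ler_wpM2l// mulr_ge0// ltW.
rewrite -(mulrA 2 (Num.sqrt alpha)); move: (Num.sqrt alpha * Rad) c0 => c c0.
have : 0 <= s * c by exact: mulr_ge0.
have : 0 <= c ^+ 2 by exact: sqr_ge0.
lra.
Qed.

(** Compare the minimizer with xh in the proximal inequality.  The linearized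
    constraints at xh are at most the values g_k(xh) by convexity, and the
    queue recursion bounds |Q(t+1)|^2 by |Q(t)|^2 plus twice the inner product
    of the queues with the increments, up to a constant. *)
Lemma queue_potential_step xh t : X0 xh -> (1 <= t)%N ->
  queue_potential xh t.+1 ^+ 2 <= queue_potential xh t ^+ 2
    + 2 * (m%:R * (G + D2 * Rad) ^+ 2 / 2 + V * (D1 * Rad))
    + 2 * \sum_(k < m) Q t 0 k * gt t k xh.
Proof.
move=> Xh t1; rewrite !sqr_queue_potential.
have Xx := iterate_in t1; have Xx' := iterate_in (isT : (1 <= t.+1)%N).
have gradg_le k y z : X0 y -> X0 z ->
    `|dotv (gradgt t k (x t)) (y - z)| <= D2 * Rad.
  move=> Xy Xz; rewrite (le_trans (normr_dotv_le _ _))//.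
  by rewrite ler_pM ?enorm_ge0 ?gradgt_le ?X0_diam.
pose a k := gt t k (x t) + dotv (gradgt t k (x t)) (x t.+1 - x t).
have hQ : dotv (Q t.+1) (Q t.+1) <= dotv (Q t) (Q t)
    + 2 * (\sum_(k < m) Q t 0 k * a k) + m%:R * (G + D2 * Rad) ^+ 2.
  have -> : m%:R * (G + D2 * Rad) ^+ 2 = \sum_(k < m) (G + D2 * Rad) ^+ 2.
    by rewrite sumr_const card_ord mulr_natl.
  rewrite mulr_sumr -!big_split /=; apply: ler_sum => k _.
  have ha : a k ^+ 2 <= (G + D2 * Rad) ^+ 2.
    rewrite -[leLHS]real_normK ?num_real// ler_pXn2r ?nnegrE//; last first.
      by rewrite addr_ge0// mulr_ge0.
    by rewrite (le_trans (ler_normD _ _))// lerD// ?gt_le ?gradg_le.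
  have -> : Q t.+1 0 k = Num.max (Q t 0 k + a k) 0.
    by rewrite (alg_Q alg t1) addrA.
  have : Num.max (Q t 0 k + a k) 0 * Num.max (Q t 0 k + a k) 0
      <= (Q t 0 k + a k) ^+ 2.
    by case: (leP 0 (Q t 0 k + a k)) => // _; rewrite mulr0 sqr_ge0.
  lra.
have hmin := proximal_minimizer X0_convex (ltW alpha0)
  (next_iterate_minimizer t1) Xh.
have hsub : \sum_(k < m) Q t 0 k * (gt t k (x t)
    + dotv (gradgt t k (x t)) (xh - x t)) <= \sum_(k < m) Q t 0 k * gt t k xh.
  apply: ler_sum => k _; rewrite ler_wpM2l ?queue_ge0//.
  exact: gradgt_subgradient.
have hf : dotv (gradft t (x t)) (xh - x t.+1) <= D1 * Rad.
  rewrite (le_trans (dotv_le_enorm _ _))//.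
  by rewrite ler_pM ?enorm_ge0 ?gradft_le ?X0_diam.
have {}hf : V * dotv (gradft t (x t)) (xh - x t.+1) <= V * (D1 * Rad).
  exact: ler_wpM2l.
have ha : \sum_(k < m) Q t 0 k * a k = \sum_(k < m) Q t 0 k * gt t k (x t)
    + \sum_(k < m) Q t 0 k * dotv (gradgt t k (x t)) (x t.+1 - x t).
  by rewrite -big_split; apply: eq_bigr => k _; rewrite mulrDr.
have hs : \sum_(k < m) Q t 0 k * (gt t k (x t)
    + dotv (gradgt t k (x t)) (xh - x t)) = \sum_(k < m) Q t 0 k * gt t k (x t)
    + \sum_(k < m) Q t 0 k * dotv (gradgt t k (x t)) (xh - x t).
  by rewrite -big_split; apply: eq_bigr => k _; rewrite mulrDr.
have e0 : 0 <= alpha * enorm (x t.+1 - x t) ^+ 2.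
  by rewrite mulr_ge0 ?sqr_ge0// ltW.
have hfs : dotv (gradft t (x t)) (xh - x t)
    = dotv (gradft t (x t)) (xh - x t.+1) + dotv (gradft t (x t)) (x t.+1 - x t).
  by rewrite -dotvDr addrA subrK.
move: hmin; rewrite !dotv_objective_gradient hfs => hmin.
lra.
Qed.

Lemma constraint_sum_le_potential T k xh z :
  X0 xh -> alpha = T%:R ->
  (forall t, (1 <= t <= T.+1)%N -> queue_potential xh t <= z) ->
  \sum_(1 <= t < T.+1) gt t k (x t) <= z + D2 * (V * D1 + m%:R * D2 * z).
Proof.
move=> Xh aT Zz.
have T0 : 0 < T%:R :> R by rewrite -aT.
have z0 : 0 <= z by exact: le_trans (queue_potential_ge0 xh 1%N) (Zz _ _).
apply: le_trans (constraint_sum_le T k) _.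
rewrite lerD//.
  by rewrite (le_trans (coord_queue_le_potential xh _ _)) ?Zz ?ltnSn.
rewrite ler_wpM2l//.
apply: le_trans (_ : \sum_(1 <= t < T.+1) (V * D1 + m%:R * D2 * z) / T%:R <= _).
  apply: ler_sum_nat => t /andP[t1 tT].
  rewrite ler_pdivlMr// mulrC -aT (le_trans (iterate_step_le t1))// lerD2l.
  rewrite (mulrC m%:R) -mulrA ler_wpM2l//.
  have -> : m%:R * z = \sum_(k < m) z by rewrite sumr_const card_ord mulr_natl.
  apply: ler_sum => j _.
  by rewrite (le_trans (coord_queue_le_potential xh t j))// Zz// t1 ltnW.
by rewrite sumr_const_nat subn1 /= -[leLHS]mulr_natr divfK// gt_eqF.
Qed.

End SamplePath.

(** * The exponential of a truncated potential *)

(** From exp y <= 1 / (1 - y) and (1 - y) (1 + y + 2 y^2) = 1 + y^2 (1 - 2 y). *)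
Lemma expR_le_quadratic (R : realType) (y : R) :
  `|y| <= 2^-1 -> expR y <= 1 + y + 2 * y ^+ 2.
Proof.
rewrite ler_norml => /andP[ly uy].
have y1 : 0 < 1 - y by lra.
have : expR y <= (1 - y)^-1.
  rewrite -[y in expR y]opprK expRN lef_pV2 ?posrE ?expR_gt0//.
  exact: expR_ge1Dx.
move/le_trans; apply.
rewrite -[leLHS]mul1r ler_pdivrMr//.
have : 0 <= y ^+ 2 * (1 - 2 * y) by rewrite mulr_ge0 ?sqr_ge0//; lra.
lra.
Qed.

(** Here Z and Z' are consecutive values of the potential, s is the part of the
    increment that depends on the new sample, and theta is the threshold above
    which the drift is negative.  Truncating from below at theta makes
    the increments bounded: the increments of Z^2 are of the order of Z. *)
Section TruncatedDrift.
Context {R : realType} (Z Z' s K G theta eps r : R).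
Hypotheses (Z0 : 0 <= Z) (theta0 : 0 < theta) (K0 : 0 <= K).
Hypotheses (eps0 : 0 < eps) (G0 : 0 < G) (r0 : 0 < r).
Hypotheses (K_le : K <= theta * (eps / 4)) (s_le : `|s| <= Z * G).
Hypothesis rd : r * (eps / 4 + G) <= 2^-1.
Hypothesis step : Z' ^+ 2 <= Z ^+ 2 + 2 * K + 2 * s.
Let M := Num.max Z theta.

Let MZ : Z <= M. Proof. by rewrite le_max lexx. Qed.
Let Mth : theta <= M. Proof. by rewrite le_max lexx orbT. Qed.
Let M0 : 0 < M. Proof. exact: lt_le_trans Mth. Qed.

Lemma truncated_increment_le : `|(K + s) / M| <= eps / 4 + G.
Proof.
rewrite -(ler_pM2r M0) -[X in _ * X <= _](gtr0_norm M0) -normrM.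
rewrite divfK ?gt_eqF// (le_trans (ler_normD _ _))// ger0_norm//.
have : Z * G <= M * G by rewrite ler_pM2r.
have : theta * (eps / 4) <= M * (eps / 4) by rewrite ler_pM2r ?divr_gt0.
by move: K_le s_le; lra.
Qed.

(** From 2 M Z' <= M^2 + Z'^2 and Z <= M. *)
Lemma potential_increment_le : Z' <= M + (K + s) / M.
Proof.
rewrite -(ler_pM2l M0) -(ler_pM2l (@ltr0n R 2)) mulrDr.
rewrite (mulrC M (_ / M)) divfK ?gt_eqF//.
have : Z ^+ 2 <= M ^+ 2 by rewrite ler_pXn2r// nnegrE// ltW.
have := sqr_ge0 (M - Z').
by move: step; lra.
Qed.

Lemma truncated_potential_step : Num.max Z' theta <= M + (eps / 4 + G).
Proof.
have := truncated_increment_le; rewrite ler_norml => /andP[_ h].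
rewrite ge_max (le_trans potential_increment_le) ?lerD2l//=.
by rewrite -[theta]addr0 lerD// addr_ge0 ?divr_ge0// ltW.
Qed.

(** The first summand covers the case where the new potential falls below the
    threshold. *)
Lemma exp_drift_step :
  expR (r * Num.max Z' theta) <=
  expR (r * theta)
  + expR (r * M) * (1 + r * (K + s) / M + 2 * (r * (eps / 4 + G)) ^+ 2).
Proof.
have main : expR (r * (M + (K + s) / M)) <=
    expR (r * M) * (1 + r * (K + s) / M + 2 * (r * (eps / 4 + G)) ^+ 2).
  rewrite mulrDr expRD ler_pM2l ?expR_gt0// -(mulrA r).
  set D := (K + s) / M.
  have rD : `|r * D| <= r * (eps / 4 + G).
    by rewrite normrM (gtr0_norm r0) ler_pM2l// truncated_increment_le.
  apply: le_trans (expR_le_quadratic (le_trans rD rd)) _.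
  rewrite lerD2l ler_pM2l// -real_normK ?num_real// ler_pXn2r// nnegrE//.
  exact: le_trans rD.
have [Z'th|thZ'] := leP Z' theta.
  by rewrite lerDl (le_trans _ main)// expR_ge0.
apply: le_trans (_ : expR (r * (M + (K + s) / M)) <= _).
  by rewrite ler_expR ler_pM2l// potential_increment_le.
by rewrite (le_trans main)// lerDr expR_ge0.
Qed.

End TruncatedDrift.

(** * Joint measurability of Lipschitz families *)

Section Caratheodory.
Context {R : realType} {n : nat}.

(** A norm that is visibly measurable, subadditive and approximable coordinate by
    coordinate; it dominates the Euclidean norm. *)
Definition taxicab (u : 'rV[R]_n) : R := \sum_(i < n) `|u 0 i|.

Lemma taxicab_ge0 u : 0 <= taxicab u.
Proof. by apply: sumr_ge0 => i _. Qed.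

Lemma ler_taxicabD u v : taxicab (u + v) <= taxicab u + taxicab v.
Proof.
by rewrite -big_split; apply: ler_sum => i _; rewrite mxE ler_normD.
Qed.

Lemma taxicabN u : taxicab (- u) = taxicab u.
Proof. by apply: eq_bigr => i _; rewrite mxE normrN. Qed.

Lemma dotv_le_taxicab u v : dotv u v <= enorm u * taxicab v.
Proof.
rewrite mulr_sumr; apply: ler_sum => i _.
by rewrite (le_trans (ler_norm _))// normrM ler_wpM2r// coord_le_enorm.
Qed.

Lemma rational_approximation (x : 'rV[R]_n) (e : R) : 0 < e ->
  exists q : 'rV[rat]_n, taxicab (x - map_mx ratr q) <= e.
Proof.
move=> e0; pose d := e / n.+1%:R.
have d0 : 0 < d by rewrite divr_gt0.
have approx i : exists q : rat, `|x 0 i - ratr q| <= d.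
  have [q] := @rat_in_itvoo R (x 0 i - d) (x 0 i + d) ltac:(lra).
  rewrite in_itv /= => /andP[l u]; exists q.
  by rewrite ler_norml; lra.
exists (\row_i xget 0 [set q : rat | `|x 0 i - ratr q| <= d]).
apply: le_trans (_ : \sum_(i < n) d <= _).
  apply: ler_sum => i _; rewrite !mxE.
  by case: xgetP => [q _ //|] ; have [q hq] := approx i => /(_ q).
rewrite sumr_const card_ord -mulr_natl /d mulrCA ger_pMr// ler_pdivrMr// mul1r.
by rewrite ler_nat.
Qed.

(** For each rational point and each radius 1 / (j + 1), pick a point of X0 in the
    corresponding ball when there is one. *)
Lemma separating_sequence (X0 : set 'rV[R]_n) (x0 : 'rV[R]_n) : X0 x0 ->
  exists z : nat -> 'rV[R]_n, (forall k, X0 (z k)) /\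
    forall (x : 'rV[R]_n) (e : R), X0 x -> 0 < e ->
      exists k, taxicab (x - z k) <= e.
Proof.
move=> X00.
pose near_grid (c : 'rV[rat]_n * nat) : set 'rV[R]_n :=
  [set y | X0 y /\ taxicab (y - map_mx ratr c.1) <= c.2.+1%:R^-1].
exists (fun k => if unpickle k is Some c then xget x0 (near_grid c) else x0).
split=> [k|x e Xx e0].
  by case: unpickle => // c; case: xgetP => // y _ [].
have [j je] : exists j : nat, 2 * j.+1%:R^-1 <= e.
  exists (Num.truncn (2 / e)).
  rewrite ler_pdivrMr// mulrC -ler_pdivrMr//.
  by rewrite ltW// truncnS_gt.
have [q xq] := @rational_approximation x j.+1%:R^-1 ltac:(by rewrite invr_gt0).
exists (pickle (q, j)); rewrite pickleK.
case: xgetP => [y _ [_ /= yq]|/(_ x)]; last by case; split.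
have := ler_taxicabD (x - map_mx ratr q) (- (y - map_mx ratr q)).
rewrite taxicabN opprB addrA subrK => /le_trans; apply.
apply: le_trans (lerD xq yq) _; rewrite -mulr2n -[_ *+ 2]mulr_natl.
exact: je.
Qed.

(** By the Lipschitz property h(x, .) is the infimum of h(z, .) + L |x - z| over a
    dense sequence of points z, and each of these is measurable. *)
Lemma measurable_caratheodory d d' (S : measurableType d) (Om : measurableType d')
    (X0 : set 'rV[R]_n) (h : 'rV[R]_n -> Om -> R) (L : R)
    (X : S -> 'rV[R]_n) (Y : S -> Om) :
  0 <= L ->
  (forall x, X0 x -> measurable_fun setT (h x)) ->
  (forall x y w, X0 x -> X0 y -> h x w <= h y w + L * taxicab (x - y)) ->
  (forall w, X0 (X w)) ->
  (forall i, measurable_fun setT (fun w => X w 0 i)) ->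
  measurable_fun setT Y ->
  measurable_fun setT (fun w => h (X w) (Y w)).
Proof.
move=> L0 mh lip XX0 mX mY.
have [z [zX0 zdense]] := separating_sequence (XX0 point).
apply: (measurability _ (RGenInftyO.measurableE R)) => // _ [_ [a ->] <-].
rewrite setTI.
have -> : (fun w => h (X w) (Y w)) @^-1` [set` Interval -oo%O (BLeft a)] =
    \bigcup_k [set w | h (z k) (Y w) + L * taxicab (X w - z k) < a].
  apply/seteqP; split => [w|w [k _ /=]]; rewrite /= in_itv /= => hwa; last first.
    exact: le_lt_trans (lip _ _ _ _ _) hwa.
  set c := a - h (X w) (Y w); have c0 : 0 < c by rewrite subr_gt0.
  (* the error is paid twice: from X w to z k, and in the added term *)
  have L1 : 0 < 2 * L + 1 by lra.
  have [k kc] := zdense (X w) (c / (2 * L + 1)) (XX0 w) (divr_gt0 c0 L1).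
  exists k => //=; have := lip (z k) (X w) (Y w) (zX0 k) (XX0 w).
  rewrite -opprB taxicabN.
  move: kc; rewrite ler_pdivlMr//; set l := taxicab _.
  have l0 : 0 <= l by exact: taxicab_ge0.
  rewrite /c; nra.
apply: bigcupT_measurable => k.
have ml : measurable_fun setT (fun w => h (z k) (Y w) + L * taxicab (X w - z k)).
  apply: measurable_funD.
    by apply: measurableT_comp => //; exact: mh.
  apply: measurable_funM => //; apply: measurable_sum => i.
  apply: measurableT_comp => //.
  under eq_fun do rewrite !mxE.
  exact: measurable_funB.
have := ml measurableT [set` Interval -oo%O (BLeft a)] (measurable_itv _).
by rewrite setTI; congr (measurable _); apply/seteqP; split => w /=; rewrite in_itv.
Qed.

End Caratheodory.

(** * Exponential moments of the potential *)

(** With V = sqrt T, the deterministic part of half the increment of the squared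
    potential is at most sqrt T times this. *)
Definition step_constant {R : realType} (m : nat) (D1 D2 G Rad : R) : R :=
  m%:R * (G + D2 * Rad) ^+ 2 / 2 + D1 * Rad.

(** The increments of the truncated potential are at most delta = eps / 4 + G.
    This rate r makes r delta at most 1 / 4, within the range of the quadratic
    bound on exp, and makes the second-order term 2 (r delta)^2 equal to
    r eps / 8, which is absorbed by the negative drift. *)
Definition decay_rate {R : realType} (G eps : R) : R :=
  eps / (16 * (eps / 4 + G) ^+ 2).

(** Above this multiple of sqrt T, the deterministic increment is at most
    eps / 4 per slot (first summand), and the distance term accounts for at
    most a quarter of the potential (second summand). *)
Definition threshold_slope {R : realType} (m : nat) (D1 D2 G Rad eps : R) : R :=
  4 * step_constant m D1 D2 G Rad / eps + 8 * Rad.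

(** The fixed point of C |-> (1 + r eps) + (1 - r eps / 4) C. *)
Definition exp_moment_constant {R : realType} (G eps : R) : R :=
  (1 + decay_rate G eps * eps) / (decay_rate G eps * (eps / 4)).

Definition potential_bound {R : realType} (m : nat) (D1 D2 G Rad eps : R)
    (T : nat) (lambda : R) : R :=
  threshold_slope m D1 D2 G Rad eps * Num.sqrt T%:R
  + ln (exp_moment_constant G eps * T.+1%:R / lambda) / decay_rate G eps.

Definition violation_bound {R : realType} (m : nat) (D1 D2 G Rad eps : R)
    (T : nat) (lambda : R) : R :=
  let z := potential_bound m D1 D2 G Rad eps T lambda in
  z + D2 * (Num.sqrt T%:R * D1 + m%:R * D2 * z).

Section PotentialMeasurability.
Context {R : realType} {n m : nat} {d : measure_display} {H : measurableType d}.
Variables (X : H -> 'rV[R]_n) (q : H -> 'rV[R]_m) (alpha theta r : R)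
  (xh : 'rV[R]_n) (t : nat).
Hypothesis mX : forall i, measurable_fun setT (fun w => X w 0 i).
Hypothesis mq : forall k, measurable_fun setT (fun w => q w 0 k).

Let trunc w :=
  Num.max (queue_potential alpha (fun _ => X w) (fun _ => q w) xh t) theta.

Lemma measurable_truncated_potential : measurable_fun setT trunc.
Proof.
apply: measurable_maxr => //.
have msqrt : measurable_fun setT (@Num.sqrt R).
  apply: continuous_measurable_fun; exact: sqrt_continuous.
rewrite /queue_potential; apply: (measurableT_comp msqrt).
apply: measurable_funD.
  by apply: measurable_sum => k; exact: measurable_funM.
apply: measurable_funM => //.
under eq_fun do rewrite sqr_enorm.
apply: measurable_sum => i.
have mD : measurable_fun setT (fun w => (xh - X w) 0 i).
  by under eq_fun do rewrite !mxE; exact: measurable_funB.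
exact: measurable_funM.
Qed.

Lemma measurable_exp_potential : measurable_fun setT (fun w => expR (r * trunc w)).
Proof.
apply: measurableT_comp => //; apply: measurable_funM => //.
exact: measurable_truncated_potential.
Qed.

Lemma measurable_inv_potential : 0 < theta ->
  measurable_fun setT (fun w => (trunc w)^-1).
Proof.
move=> th0.
have -> : (fun w => (trunc w)^-1) = (fun w => trunc w `^ (-1)).
  apply/funext => w; rewrite powR_inv1// le_max (ltW th0) orbT//.
apply: (measurableT_comp (measurable_powR (-1))).
exact: measurable_truncated_potential.
Qed.

Lemma measurable_queue_weight k : 0 < theta ->
  measurable_fun setT (fun w => expR (r * trunc w) * (q w 0 k / trunc w)).
Proof.
move=> th0; apply: measurable_funM; first exact: measurable_exp_potential.
by apply: measurable_funM => //; exact: measurable_inv_potential.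
Qed.

End PotentialMeasurability.

Section ExponentialMoment.
Context {R : realType} {n m : nat}.
Variables (D1 D2 G Rad eps : R).
Hypotheses (hD1 : 0 < D1) (hD2 : 0 < D2) (hG : 0 < G) (hRad : 0 < Rad)
  (heps : 0 < eps).
Variable X0 : set 'rV[R]_n.
Context d (S : measurableType d) (P : probability S R)
  d' (Om : measurableType d') (mu : probability Om R).
Variables (om : nat -> {RV P >-> Om}) (g : 'I_m -> 'rV[R]_n -> Om -> R)
  (gradg : 'I_m -> 'rV[R]_n -> Om -> 'rV[R]_n)
  (gradf : nat -> S -> 'rV[R]_n -> 'rV[R]_n)
  (x : nat -> S -> 'rV[R]_n) (Q : nat -> S -> 'rV[R]_m) (T : nat).
Hypotheses (X0_convex : convex_set X0) (samples : iid_samples mu om)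
  (constraints : constraint_functions X0 g gradg)
  (bounds : basic_assumption X0 D1 D2 G Rad g gradg gradf).
Variable xh : 'rV[R]_n.
Hypotheses (Xxh : X0 xh) (slater : forall k, ('E_mu[g k xh] <= (- eps)%:E)%E).
Hypothesis alg : forall w : S,
  algorithm1 X0 (Num.sqrt T%:R) T%:R
    (fun t j y => g j y (om t w)) (fun t j y => gradg j y (om t w))
    (fun t => gradf t w) (fun t => x t w) (fun t => Q t w).
Hypothesis adapted : forall t, (1 <= t)%N ->
  measurable_wrt (history om t.-1) (x t) /\
  measurable_wrt (history om t.-1) (Q t).
Hypothesis T1 : (1 <= T)%N.

Let sT : R := Num.sqrt T%:R.
Let theta := threshold_slope m D1 D2 G Rad eps * sT.
Let r := decay_rate G eps.
Let K := m%:R * (G + D2 * Rad) ^+ 2 / 2 + sT * (D1 * Rad).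

Let T0 : 0 < T%:R :> R. Proof. by rewrite ltr0n. Qed.

Let sT1 : 1 <= sT.
Proof. by rewrite -sqrtr1 ler_wsqrtr// ler1n. Qed.

Let sT0 : 0 <= sT. Proof. exact: sqrtr_ge0. Qed.

Let step_constant0 : 0 < step_constant m D1 D2 G Rad.
Proof.
by rewrite ltr_wpDl ?mulr_gt0// divr_ge0// mulr_ge0// sqr_ge0.
Qed.

Let slope0 : 0 < threshold_slope m D1 D2 G Rad eps.
Proof. by rewrite addr_gt0 ?divr_gt0 ?mulr_gt0. Qed.

Let theta0 : 0 < theta.
Proof. by rewrite mulr_gt0// (lt_le_trans ltr01). Qed.

Let K0 : 0 <= K.
Proof.
apply: addr_ge0; last by rewrite mulr_ge0// mulr_ge0// ltW.
by rewrite divr_ge0// mulr_ge0// sqr_ge0.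
Qed.

Let K_le : K <= theta * (eps / 4).
Proof.
have -> : theta * (eps / 4)
    = sT * step_constant m D1 D2 G Rad + 2 * Rad * eps * sT.
  by rewrite /theta /threshold_slope; field; rewrite gt_eqF.
have h : m%:R * (G + D2 * Rad) ^+ 2 / 2 <= sT * (m%:R * (G + D2 * Rad) ^+ 2 / 2).
  by rewrite ler_peMl// divr_ge0// mulr_ge0// sqr_ge0.
by rewrite /K /step_constant mulrDr -addrA lerD// lerDl !mulr_ge0// ltW//.
Qed.

Let diameter_le : 2 * sT * Rad <= theta / 4.
Proof.
have -> : theta / 4
    = 2 * sT * Rad + step_constant m D1 D2 G Rad / eps * sT.
  by rewrite /theta /threshold_slope; field; rewrite gt_eqF.
by rewrite lerDl mulr_ge0// divr_ge0// ltW.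
Qed.

Let delta0 : 0 < eps / 4 + G. Proof. by rewrite addr_gt0 ?divr_gt0. Qed.

Let r0 : 0 < r.
Proof. by rewrite divr_gt0 ?mulr_gt0 ?exprn_gt0. Qed.

Let r_delta : r * (eps / 4 + G) <= 2^-1.
Proof.
have -> : r * (eps / 4 + G) = eps / (16 * (eps / 4 + G)).
  by rewrite /r /decay_rate; field; rewrite gt_eqF//; move: heps hG; lra.
by rewrite ler_pdivrMr ?mulr_gt0//; move: heps hG; lra.
Qed.

Let r_delta_sqr : 2 * (r * (eps / 4 + G)) ^+ 2 = r * (eps / 8).
Proof.
by rewrite /r /decay_rate; field; rewrite gt_eqF//; move: heps hG; lra.
Qed.

Let r_eps : r * (eps / 4) <= 1.
Proof.
apply: le_trans (_ : r * (eps / 4 + G) <= _).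
  by rewrite ler_pM2l// lerDl ltW.
by rewrite (le_trans r_delta)//; lra.
Qed.

Let g_vec_le w y : X0 y -> enorm (\row_k g k y w) <= G.
Proof. by move=> Xy; exact: (g_bound bounds). Qed.

Let g_le k w y : X0 y -> `|g k y w| <= G.
Proof.
move=> Xy; apply: le_trans (g_vec_le w Xy).
by have := coord_le_enorm (\row_k g k y w) k; rewrite mxE.
Qed.

Let gradf_le w t : (1 <= t)%N -> forall y, X0 y -> enorm (gradf t w y) <= D1.
Proof. by move=> t1 y Xy; exact: (gradf_bound bounds). Qed.

Let gradg_le w (t : nat) k y : X0 y -> enorm (gradg k y (om t w)) <= D2.
Proof. by move=> Xy; exact: (gradg_bound bounds). Qed.

Let diam y z : X0 y -> X0 z -> enorm (y - z) <= Rad.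
Proof. exact: (diameter_bound bounds). Qed.

Let subg w (t : nat) k y : X0 y ->
  subgradient X0 (fun y => g k y (om t w)) y (gradg k y (om t w)).
Proof. by move=> Xy; exact: (constraint_subgradient constraints). Qed.

Let Z t w := queue_potential T%:R (fun t => x t w) (fun t => Q t w) xh t.

Definition truncated_potential t w := Num.max (Z t w) theta.
Local Notation M := truncated_potential.

Definition exp_potential t w := expR (r * M t w).
Local Notation Y := exp_potential.

(** The coefficient of g_k(xh) in the linearized increment of the exponential of
    the potential; it depends on the past only. *)
Definition queue_weight t k w := Y t w * (Q t w 0 k / M t w).
Local Notation U := queue_weight.

Let MZ t w : Z t w <= M t w. Proof. by rewrite le_max lexx. Qed.
Let Mth t w : theta <= M t w. Proof. by rewrite le_max lexx orbT. Qed.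
Let M0 t w : 0 < M t w. Proof. exact: lt_le_trans (Mth t w). Qed.
Let Y0 t w : 0 <= Y t w. Proof. exact: expR_ge0. Qed.

Let Q0 t w k : (1 <= t)%N -> 0 <= Q t w 0 k.
Proof. by move=> t1; exact: (queue_ge0 (alg w) k t1). Qed.

Let drift t w := \sum_(k < m) Q t w 0 k * g k xh (om t w).

Let g_vec_le_at w (t : nat) y : X0 y -> enorm (\row_k g k y (om t w)) <= G.
Proof. exact: g_vec_le. Qed.

Let drift_le t w : `|drift t w| <= Z t w * G.
Proof.
exact: (normr_drift_le (fun t => x t w) (fun t => Q t w) T0 (g_vec_le_at w)
  t Xxh).
Qed.

Let Z_step t w : (1 <= t)%N ->
  Z t.+1 w ^+ 2 <= Z t w ^+ 2 + 2 * K + 2 * drift t w.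
Proof.
move=> t1; exact: (queue_potential_step (alg w) X0_convex sT0 T0 (ltW hD2)
  (ltW hG) (ltW hRad) (gradf_le w) (gradg_le w) (g_vec_le_at w) diam (subg w)
  Xxh t1).
Qed.

Let Z_le_sum t w : (1 <= t)%N ->
  Z t w <= \sum_(k < m) Q t w 0 k + 2 * sT * Rad.
Proof.
by move=> t1; exact: (potential_le_queue_sum (alg w) T0 (ltW hRad) diam Xxh t1).
Qed.

Let Z0 t w : 0 <= Z t w. Proof. exact: queue_potential_ge0. Qed.

Let Qk_le t w k : Q t w 0 k <= M t w.
Proof.
exact: le_trans (coord_queue_le_potential _ _ T0 _ _ _) (MZ t w).
Qed.

Let M_first w : M 1 w = theta.
Proof.
apply/max_idPr; apply: le_trans (Z_le_sum w (isT : (1 <= 1)%N)) _.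
rewrite big1 ?add0r => [|k _]; last by rewrite (alg_Q1 (alg w)).
apply: le_trans diameter_le _; rewrite ler_pdivrMr//.
by move: theta0; lra.
Qed.

Let M_step t w : (1 <= t)%N -> M t.+1 w <= M t w + (eps / 4 + G).
Proof.
move=> t1; exact: (truncated_potential_step (Z0 t w) theta0 K0 heps hG K_le
  (drift_le t w) (Z_step w t1)).
Qed.

Let M_bounded t w : (1 <= t)%N -> M t w <= theta + t%:R * (eps / 4 + G).
Proof.
case: t => // t _; elim: t => [|t IH].
  by rewrite M_first mul1r lerDl ltW.
rewrite (le_trans (M_step w _))// -[t.+2]addn1 natrD mulrDl mul1r [leRHS]addrA.
by rewrite lerD2r.
Qed.

Let Y_step t w : (1 <= t)%N ->
  Y t.+1 w <= expR (r * theta)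
    + Y t w * (1 + r * (K + drift t w) / M t w + r * (eps / 8)).
Proof.
move=> t1; rewrite -r_delta_sqr.
exact: (exp_drift_step (Z0 t w) theta0 K0 heps hG r0 K_le
  (drift_le t w) r_delta (Z_step w t1)).
Qed.

(** Above the threshold the negative drift eps sum Q_k / M >= 3 eps / 4 beats the
    deterministic increment (at most eps / 4) and the second-order term (eps / 8);
    below it, the additive constant absorbs everything. *)
Let contraction t w : (1 <= t)%N ->
  Y t w * (1 + r * K / M t w + r * (eps / 8)) - r * eps * \sum_(k < m) U t k w
  <= (1 - r * (eps / 4)) * Y t w + r * eps * expR (r * theta).
Proof.
move=> t1.
have -> : \sum_(k < m) U t k w = Y t w * (\sum_(k < m) Q t w 0 k / M t w).
  by rewrite mulr_sumr.
rewrite -mulr_suml.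
set q := (\sum_(k < m) Q t w 0 k) / M t w.
have q0 : 0 <= q.
  by rewrite divr_ge0 ?(ltW (M0 t w))//; apply: sumr_ge0 => k _; exact: Q0.
have KM : r * K / M t w <= r * (eps / 4).
  rewrite -mulrA ler_pM2l// ler_pdivrMr// (le_trans K_le)// mulrC.
  by rewrite ler_pM2l ?divr_gt0 ?Mth.
have e0 : 0 <= r * eps by rewrite mulr_ge0// ltW.
have [Zth|thZ] := leP (Z t w) theta.
  have MY : Y t w = expR (r * theta) by rewrite /Y /M (max_idPr Zth).
  have : 0 <= r * eps * (Y t w * q) by rewrite mulr_ge0// mulr_ge0// Y0.
  have : Y t w * (1 + r * K / M t w + r * (eps / 8))
      <= Y t w * (1 + r * (eps / 4) + r * (eps / 8)).
    by rewrite ler_wpM2l ?Y0// !lerD2r lerD2l.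
  have : 0 <= r * eps * Y t w by rewrite mulr_ge0 ?Y0.
  by rewrite -MY; lra.
have q34 : 3 / 4 <= q.
  rewrite ler_pdivlMr//.
  have MY : M t w = Z t w by rewrite /M; exact/max_idPl/ltW.
  have := Z_le_sum w t1; have := diameter_le; rewrite MY; move: thZ; lra.
have : 0 <= r * eps * expR (r * theta) by rewrite mulr_ge0// expR_ge0.
have : Y t w * (1 + r * K / M t w + r * (eps / 8) - r * eps * q)
    <= Y t w * (1 - r * (eps / 4)).
  rewrite ler_wpM2l ?Y0//.
  have : r * eps * (3 / 4) <= r * eps * q by exact: ler_wpM2l.
  by move: KM; lra.
lra.
Qed.

Let excess k z := eps + g k xh z.

Let Y_drift t w : (1 <= t)%N ->
  Y t.+1 w <= (1 + r * eps) * expR (r * theta) + ((1 - r * (eps / 4)) * Y t w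
    + r * \sum_(k < m) U t k w * excess k (om t w)).
Proof.
move=> t1; apply: le_trans (Y_step w t1) _.
have := contraction w t1.
have -> : \sum_(k < m) U t k w * excess k (om t w)
    = eps * \sum_(k < m) U t k w + Y t w * (drift t w / M t w).
  rewrite mulr_sumr mulr_suml mulr_sumr -big_split; apply: eq_bigr => k _ /=.
  by rewrite /queue_weight /excess; ring.
have -> : r * (K + drift t w) / M t w = r * K / M t w + r * (drift t w / M t w).
  by rewrite mulrDr mulrDl !mulrA.
lra.
Qed.

Let mx t : (1 <= t)%N -> forall i,
  measurable_fun setT (fun w : history_type om t.-1 => x t w 0 i).
Proof.
by move=> t1 i _ A mA; rewrite setTI; have [+ _] := adapted t1; apply.
Qed.

Let mQ t : (1 <= t)%N -> forall k,
  measurable_fun setT (fun w : history_type om t.-1 => Q t w 0 k).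
Proof.
by move=> t1 k _ A mA; rewrite setTI; have [_] := adapted t1; apply.
Qed.

Let mU t k : (1 <= t)%N ->
  measurable_fun setT (U t k : history_type om t.-1 -> R).
Proof.
by move=> t1; exact: (measurable_queue_weight T%:R r xh t (mx t1) (mQ t1) k theta0).
Qed.

Let mY t : (1 <= t)%N -> measurable_fun setT (Y t).
Proof.
move=> t1; apply: (@measurable_from_history _ _ _ P _ _ om t.-1).
exact: (measurable_exp_potential T%:R theta r xh t (mx t1) (mQ t1)).
Qed.

Let Ymax t := expR (r * (theta + t%:R * (eps / 4 + G))).

Let Y_le t w : (1 <= t)%N -> Y t w <= Ymax t.
Proof. by move=> t1; rewrite ler_expR ler_pM2l// M_bounded. Qed.

Lemma integrable_exp_potential t : (1 <= t)%N ->
  P.-integrable setT (EFin \o Y t).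
Proof.
move=> t1; apply: (@bounded_integrable _ _ _ _ _ (Ymax t)); first exact: mY.
by move=> w; rewrite ger0_norm ?Y0// Y_le.
Qed.

Let U_le t k w : (1 <= t)%N -> 0 <= U t k w <= Ymax t.
Proof.
move=> t1; have QM0 : 0 <= Q t w 0 k / M t w.
  by rewrite divr_ge0 ?Q0// ltW// M0.
rewrite mulr_ge0 ?Y0//= (le_trans _ (Y_le w t1))// ler_piMr ?Y0//.
by rewrite ler_pdivrMr ?M0// mul1r Qk_le.
Qed.

Let mg k : measurable_fun setT (g k xh).
Proof. exact: (constraint_measurable constraints). Qed.

Let mexcess k : measurable_fun setT (excess k).
Proof. exact: measurable_funD. Qed.

Let excess_le k z : `|excess k z| <= eps + G.
Proof.
by rewrite (le_trans (ler_normD _ _))// (gtr0_norm heps) lerD2l g_le.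
Qed.

Let excess_mean k : \int[mu]_z excess k z <= 0.
Proof.
have ig : mu.-integrable setT (EFin \o g k xh).
  by apply: (@bounded_integrable _ _ _ _ _ G) => // z; exact: g_le.
have ie : mu.-integrable setT (EFin \o cst eps).
  by apply: (@bounded_integrable _ _ _ _ _ eps) => // z; rewrite gtr0_norm.
rewrite (RintegralD measurableT ie ig).
rewrite Rintegral_probability_cst -lerBrDl sub0r -lee_fin.
apply: le_trans (slater k).
by rewrite unlock /Rintegral fineK//; exact: integrable_fin_num.
Qed.

Let product_mean t k : (1 <= t)%N ->
  \int[P]_w (U t k w * excess k (om t w)) <= 0.
Proof.
move=> t1.
rewrite (Rintegral_mul_history samples t1 (mU k t1) (mexcess k)
  (fun w => U_le k w t1) (excess_le k)).
rewrite mulr_ge0_le0//; apply: Rintegral_ge0 => w _.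
by have /andP[] := U_le k w t1.
Qed.

Let integrable_product t k : (1 <= t)%N ->
  P.-integrable setT (EFin \o (fun w => U t k w * excess k (om t w))).
Proof.
move=> t1; apply: (@bounded_integrable _ _ _ _ _ (Ymax t * (eps + G))).
  apply: measurable_funM; first exact: measurable_from_history (mU k t1).
  exact: measurableT_comp.
move=> w; rewrite normrM; have /andP[U0 Ule] := U_le k w t1.
by rewrite ler_pM// ger0_norm.
Qed.

(** The fresh sample appears in [Y_drift] only through products of a nonnegative
    function of the past and eps + g_k(xh), whose expectation is nonpositive. *)
Lemma exp_potential_drift t : (1 <= t)%N ->
  \int[P]_w Y t.+1 w <=
  (1 + r * eps) * expR (r * theta) + (1 - r * (eps / 4)) * \int[P]_w Y t w.
Proof.
move=> t1.
pose a := (1 + r * eps) * expR (r * theta).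
pose b := 1 - r * (eps / 4).
have ia : P.-integrable setT (EFin \o cst a).
  by apply: (@bounded_integrable _ _ _ _ _ `|a|).
have iY := integrable_exp_potential t1.
have ibY : P.-integrable setT (EFin \o (fun w => b * Y t w)).
  exact: (integrableZl measurableT b iY).
have iS : P.-integrable setT
    (EFin \o (fun w => \sum_(k < m) U t k w * excess k (om t w))).
  exact: (integrable_Rsum _ (fun k => integrable_product k t1)).
have irS : P.-integrable setT
    (EFin \o (fun w => r * \sum_(k < m) U t k w * excess k (om t w))).
  exact: (integrableZl measurableT r iS).
have ibS : P.-integrable setT (EFin \o (fun w => b * Y t w
    + r * \sum_(k < m) U t k w * excess k (om t w))).
  exact: (integrableD measurableT ibY irS).
have iall : P.-integrable setT (EFin \o (fun w => cst a w + (b * Y t w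
    + r * \sum_(k < m) U t k w * excess k (om t w)))).
  exact: (integrableD measurableT ia ibS).
have iY' := @integrable_exp_potential t.+1 isT.
apply: le_trans (le_Rintegral measurableT iY' iall (fun w _ => Y_drift w t1)) _.
rewrite (RintegralD measurableT ia ibS) (RintegralD measurableT ibY irS).
rewrite (RintegralZl b measurableT iY) (RintegralZl r measurableT iS).
rewrite (Rintegral_sum _ (fun k => integrable_product k t1)).
rewrite Rintegral_probability_cst lerD2l gerDl pmulr_rle0//.
by apply: sumr_le0 => k _; exact: product_mean.
Qed.

Lemma exp_moment_le t : (1 <= t)%N ->
  \int[P]_w Y t w <= exp_moment_constant G eps * expR (r * theta).
Proof.
have rho0 : 0 < r * (eps / 4) by rewrite mulr_gt0// divr_gt0.
have CE : exp_moment_constant G eps * (r * (eps / 4)) = 1 + r * eps.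
  by rewrite divfK// gt_eqF.
have re0 : 0 < r * eps by rewrite mulr_gt0.
set C := exp_moment_constant G eps in CE *.
case: t => // t _; elim: t => [|t IH].
  have -> : \int[P]_w Y 1 w = expR (r * theta).
    under eq_Rintegral do rewrite /exp_potential M_first.
    exact: Rintegral_probability_cst.
  rewrite ler_peMl ?expR_ge0// -(ler_pM2r rho0) CE mul1r.
  by move: r_eps re0; lra.
apply: le_trans (@exp_potential_drift t.+1 isT) _.
have b0 : 0 <= 1 - r * (eps / 4) by rewrite subr_ge0.
apply: le_trans (_ : (1 + r * eps) * expR (r * theta)
  + (1 - r * (eps / 4)) * (C * expR (r * theta)) <= _).
  by rewrite lerD2l ler_wpM2l.
by rewrite -CE; lra.
Qed.

(** The subgradient inequality makes g_k Lipschitz on X0, with constant D2. *)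
Lemma measurable_constraint_value t k : (1 <= t)%N ->
  measurable_fun setT (fun w => g k (x t w) (om t w)).
Proof.
move=> t1.
apply: (measurable_caratheodory (h := g k) (L := D2) (X0 := X0)) => //.
- exact: ltW.
- by move=> y Xy; exact: (constraint_measurable constraints).
- move=> y z w Xy Xz.
  have := constraint_subgradient constraints k w Xy Xz.
  rewrite -opprB dotvNr lerBlDr => h; apply: le_trans h _.
  rewrite lerD2l (le_trans (dotv_le_taxicab _ _))// ler_wpM2r ?taxicab_ge0//.
  exact: (gradg_bound bounds).
- by move=> w; exact: (iterate_in (alg w) t1).
- move=> i; apply: (@measurable_from_history _ _ _ P _ _ om t.-1).
  exact: mx.
Qed.

(** Markov's inequality for the sum of the exponentials handles all times at
    once: if the sum is less than a, then so is each term. *)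
Theorem constraint_violation_whp lambda k : 0 < lambda ->
  ((1 - lambda)%:E <= P [set w | (\sum_(1 <= t < T.+1) g k (x t w) (om t w)
     <= violation_bound m D1 D2 G Rad eps T lambda)%R])%E.
Proof.
move=> l0; rewrite /violation_bound.
set z := potential_bound m D1 D2 G Rad eps T lambda.
have C0 : 0 < exp_moment_constant G eps.
  have rho0 : 0 < r * (eps / 4) by rewrite mulr_gt0// divr_gt0.
  by rewrite divr_gt0// addr_gt0// mulr_gt0.
set C := exp_moment_constant G eps in C0.
set A := (X in P X).
have mA : measurable A.
  have := measurable_fun_le measurableT
    (f := fun w => \sum_(1 <= t < T.+1) g k (x t w) (om t w))
    (g := cst (z + D2 * (sT * D1 + m%:R * D2 * z))) _ (measurable_cst _).
  rewrite setTI; apply.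
  under eq_fun do rewrite big_add1 big_mkord.
  apply: measurable_sum => t; exact: measurable_constraint_value.
pose a := C * expR (r * theta) * T.+1%:R / lambda.
have a0 : 0 < a by rewrite divr_gt0// mulr_gt0// mulr_gt0// expR_gt0.
apply: (markov_complement (X := fun w => \sum_(t < T.+1) Y t.+1 w) (a := a)
  (c := T.+1%:R * (C * expR (r * theta)))) => //.
- by apply: measurable_sum => t; exact: mY.
- by move=> w; apply: sumr_ge0 => t _; exact: Y0.
- exact: (integrable_Rsum _
    (fun t : 'I_T.+1 => @integrable_exp_potential t.+1 isT)).
- rewrite (Rintegral_sum _ (fun t : 'I_T.+1 => @integrable_exp_potential t.+1 isT)).
  apply: le_trans (_ : \sum_(t < T.+1) (C * expR (r * theta)) <= _).
    by apply: ler_sum => t _; exact: exp_moment_le.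
  by rewrite sumr_const card_ord -[leLHS]mulr_natl.
- by rewrite [leRHS]mulrC /a divfK ?gt_eqF// mulrC.
move=> w Ya; rewrite /A /=.
apply: (constraint_sum_le_potential (alg w) sT0 T0 (ltW hD2) (gradf_le w)
  (gradg_le w) k Xxh erefl) => t /andP[t1 tT].
apply: le_trans (MZ t w) _.
have {}Ya : Y t w < a.
  apply: le_lt_trans Ya.
  have tlt : (t.-1 < T.+1)%N by rewrite prednK.
  rewrite (bigD1 (Ordinal tlt))//= prednK// lerDl.
  by apply: sumr_ge0 => j _; exact: Y0.
rewrite /z /potential_bound -lerBlDl ler_pdivlMr// mulrBl lerBlDr addrC.
have lnaE : ln a = r * theta + ln (C * T.+1%:R / lambda).
  have -> : a = expR (r * theta) * (C * T.+1%:R / lambda) by rewrite /a; ring.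
  rewrite lnM ?expRK// posrE ?expR_gt0//.
  by rewrite divr_gt0// mulr_gt0.
rewrite -/C -/r -/theta mulrC (mulrC theta) -lnaE -(expRK (r * M t w)).
by rewrite ler_ln ?posrE ?expR_gt0// ltW.
Qed.

End ExponentialMoment.

(** * Growth of the violation bound *)

Lemma decay_rate_gt0 (R : realType) (G eps : R) :
  0 < G -> 0 < eps -> 0 < decay_rate G eps.
Proof.
by move=> G0 e0; rewrite divr_gt0// mulr_gt0// exprn_gt0// addr_gt0// divr_gt0.
Qed.

Lemma exp_moment_constant_ge1 (R : realType) (G eps : R) :
  0 < G -> 0 < eps -> 1 <= exp_moment_constant G eps.
Proof.
move=> G0 e0; have r0 := decay_rate_gt0 G0 e0.
have re0 : 0 < decay_rate G eps * (eps / 4) by rewrite mulr_gt0// divr_gt0.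
by rewrite ler_pdivlMr// mul1r; lra.
Qed.

Lemma threshold_slope_ge0 (R : realType) (m : nat) (D1 D2 G Rad eps : R) :
  0 < D1 -> 0 < Rad -> 0 < eps -> 0 <= threshold_slope m D1 D2 G Rad eps.
Proof.
move=> D10 R0 e0.
have s0 : 0 <= step_constant m D1 D2 G Rad.
  apply: addr_ge0; last by rewrite mulr_ge0// ltW.
  by rewrite divr_ge0// mulr_ge0// sqr_ge0.
apply: addr_ge0; last by rewrite mulr_ge0// ltW.
by rewrite divr_ge0 ?(ltW e0)// mulr_ge0.
Qed.

(** Each term of the violation bound is compared with
    sqrt T log T log (1 / lambda); the factors log T and log (1 / lambda) are
    bounded below by log 2 and log (1 / lambda0). *)
Section Growth.
Context {R : realType} (T : nat) (lambda lambda0 : R).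
Hypotheses (T2 : (2 <= T)%N) (l0 : 0 < lambda) (ll : lambda <= lambda0)
  (l1 : lambda0 < 1).

Let u : R := Num.sqrt T%:R.
Let l : R := ln T%:R.
Let p : R := ln (1 / lambda).
Let l2 : R := ln 2.
Let p0 : R := ln (1 / lambda0).

Lemma ln2_gt0 : 0 < l2. Proof. by rewrite ln_gt0// ltr1n. Qed.

Lemma ln_confidence_gt0 : 0 < p0.
Proof.
rewrite ln_gt0// ltr_pdivlMr ?mul1r//; exact: lt_le_trans ll.
Qed.

Let u1 : 1 <= u.
Proof. by rewrite -sqrtr1 ler_wsqrtr// ler1n ltnW. Qed.

Let l_ge : l2 <= l.
Proof. by rewrite ler_ln ?posrE ?ltr0n ?ler_nat// ltnW. Qed.

Let p_ge : p0 <= p.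
Proof.
have L0 : 0 < lambda0 by exact: lt_le_trans ll.
by rewrite ler_ln ?posrE ?divr_gt0// !div1r lef_pV2.
Qed.

Let l_gt0 : 0 < l. Proof. exact: lt_le_trans ln2_gt0 l_ge. Qed.
Lemma ln_inv_gt0 : 0 < p. Proof. exact: lt_le_trans ln_confidence_gt0 p_ge. Qed.

Lemma growth_ge0 : 0 <= u * l * p.
Proof.
apply: mulr_ge0; last exact: ltW ln_inv_gt0.
by apply: mulr_ge0; [exact: sqrtr_ge0|exact: ltW].
Qed.

Lemma sqrt_le_growth : u <= (l2 * p0)^-1 * (u * l * p).
Proof.
have c0 : 0 < l2 * p0 by rewrite mulr_gt0 ?ln2_gt0 ?ln_confidence_gt0.
rewrite mulrC ler_pdivlMr// -mulrA ler_wpM2l ?sqrtr_ge0//.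
apply: ler_pM l_ge p_ge; apply: ltW; first exact: ln2_gt0.
exact: ln_confidence_gt0.
Qed.

Lemma const_le_growth : 1 <= (l2 * p0)^-1 * (u * l * p).
Proof. exact: le_trans u1 sqrt_le_growth. Qed.

Lemma ln_horizon_le_growth : ln T.+1%:R <= 2 / p0 * (u * l * p).
Proof.
have h : ln T.+1%:R <= 2 * l.
  have T0 : 0 < T%:R :> R by rewrite ltr0n ltnW.
  rewrite mulr_natl -lnXn// ler_ln ?posrE ?exprn_gt0// -natrX ler_nat.
  by rewrite expnS expn1; nia.
apply: le_trans h _.
rewrite mulrAC ler_pdivlMr ?ln_confidence_gt0// -(mulrA 2) ler_wpM2l//.
apply: le_trans (_ : l * p <= _); first by rewrite ler_wpM2l ?p_ge// ltW.
rewrite -(mulrA u); apply: ler_peMl u1.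
by rewrite mulr_ge0// ltW// ln_inv_gt0.
Qed.

Lemma ln_confidence_le_growth : p <= l2^-1 * (u * l * p).
Proof.
rewrite mulrC ler_pdivlMr ?ln2_gt0// mulrC.
apply: ler_wpM2r; first exact: ltW ln_inv_gt0.
by apply: le_trans l_ge _; apply: ler_peMl u1; exact: ltW.
Qed.

End Growth.

Lemma violation_bound_bigO (R : realType) (m : nat) (D1 D2 G Rad eps : R) :
  0 < D1 -> 0 < D2 -> 0 < G -> 0 < Rad -> 0 < eps ->
  bigO_horizon_confidence (violation_bound m D1 D2 G Rad eps)
    (fun T lambda => Num.sqrt T%:R * ln T%:R * ln (1 / lambda)).
Proof.
move=> D10 D20 G0 Rad0 eps0 lambda0 /andP[lambda00 lambda01].
set c0 := threshold_slope m D1 D2 G Rad eps.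
have c0_ge0 : 0 <= c0 by exact: threshold_slope_ge0.
set C := exp_moment_constant G eps.
have C1 : 1 <= C by exact: exp_moment_constant_ge1.
have lnC : 0 <= ln C by exact: ln_ge0.
set r := decay_rate G eps.
have r0 : 0 < r by exact: decay_rate_gt0.
set l2 : R := ln 2; set p0 := ln (1 / lambda0).
have l20 : 0 < l2 by exact: ln2_gt0.
have p00 : 0 < p0 := ln_confidence_gt0 lambda00 (lexx _) lambda01.
pose kappa := (l2 * p0)^-1.
have kappa0 : 0 < kappa by rewrite invr_gt0 mulr_gt0.
pose zeta := c0 * kappa + (ln C * kappa + (2 / p0 + l2^-1)) / r.
have zeta0 : 0 <= zeta.
  apply: addr_ge0; first by rewrite mulr_ge0// ltW.
  rewrite divr_ge0 ?(ltW r0)//; apply: addr_ge0.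
    by rewrite mulr_ge0// ltW.
  by apply: addr_ge0; [rewrite divr_ge0// ltW|rewrite invr_ge0 ltW].
exists (zeta + D2 * (kappa * D1 + m%:R * D2 * zeta)).
  rewrite ltr_wpDl// mulr_gt0//; apply: ltr_pwDl; first exact: mulr_gt0.
  by rewrite mulr_ge0// mulr_ge0// ltW.
move=> T lambda T2 /andP[l0 ll].
have h1 := sqrt_le_growth T2 l0 ll lambda01.
have h2 := const_le_growth T2 l0 ll lambda01.
have h3 := ln_horizon_le_growth T2 l0 ll lambda01.
have h4 := ln_confidence_le_growth T2 l0 ll lambda01.
have w0 := growth_ge0 T2 l0 ll lambda01.
rewrite (ger0_norm w0).
move: h1 h2 h3 h4 w0; rewrite -/l2 -/p0 -/kappa.
set w := Num.sqrt T%:R * ln T%:R * ln (1 / lambda) => h1 h2 h3 h4 w0.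
have lnE : ln (C * T.+1%:R / lambda) = ln C + ln T.+1%:R + ln (1 / lambda).
  have Cgt0 : 0 < C by exact: lt_le_trans C1.
  have CT0 : 0 < C * T.+1%:R by rewrite mulr_gt0.
  rewrite div1r lnM ?posrE ?invr_gt0//.
  by rewrite lnM ?posrE.
set z := potential_bound m D1 D2 G Rad eps T lambda.
have p_ge0 : 0 <= ln (1 / lambda) := ltW (ln_inv_gt0 l0 ll lambda01).
have lnT0 : 0 <= ln (T.+1%:R : R) by rewrite ln_ge0// ler1n.
have z0 : 0 <= z.
  rewrite addr_ge0 ?mulr_ge0 ?sqrtr_ge0//; last by rewrite invr_ge0 ltW.
  by rewrite -/C lnE !addr_ge0.
have zw : z <= zeta * w.
  rewrite /z /potential_bound -/C -/r -/c0 lnE /zeta [leRHS]mulrDl lerD//.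
    by rewrite -mulrA ler_wpM2l.
  rewrite [leRHS]mulrAC ler_pM2r ?invr_gt0//.
  have : ln C * 1 <= ln C * (kappa * w) by rewrite ler_wpM2l.
  lra.
have B0 : 0 <= violation_bound m D1 D2 G Rad eps T lambda.
  rewrite /violation_bound -/z; apply: addr_ge0 => //.
  apply: mulr_ge0; first exact: ltW.
  apply: addr_ge0; first by rewrite mulr_ge0 ?sqrtr_ge0// ltW.
  by rewrite mulr_ge0// mulr_ge0// ltW.
rewrite (ger0_norm B0) /violation_bound -/z.
have a1 : Num.sqrt T%:R * D1 <= kappa * w * D1 by rewrite ler_pM2r.
have a2 : m%:R * D2 * z <= m%:R * D2 * (zeta * w).
  by rewrite ler_wpM2l// mulr_ge0// ltW.
have a3 : D2 * (Num.sqrt T%:R * D1 + m%:R * D2 * z)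
    <= D2 * (kappa * w * D1 + m%:R * D2 * (zeta * w)).
  by rewrite ler_pM2l// lerD.
lra.
Qed.

Theorem theorem3 (R : realType) (m : nat) (D1 D2 G Rad eps : R)
    (hD1 : 0 < D1) (hD2 : 0 < D2) (hG : 0 < G) (hRad : 0 < Rad)
    (heps : 0 < eps) :
  exists2 B : nat -> R -> R,
    bigO_horizon_confidence B
      (fun T lambda => Num.sqrt T%:R * ln T%:R * ln (1 / lambda)) &
    forall (n : nat) (X0 : set 'rV[R]_n)
      (d : measure_display) (S : measurableType d) (P : probability S R)
      (d' : measure_display) (Om : measurableType d') (mu : probability Om R)
      (om : nat -> {RV P >-> Om})
      (g : 'I_m -> 'rV[R]_n -> Om -> R)
      (gradg : 'I_m -> 'rV[R]_n -> Om -> 'rV[R]_n)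
      (f : nat -> S -> 'rV[R]_n -> R)
      (gradf : nat -> S -> 'rV[R]_n -> 'rV[R]_n)
      (x : nat -> S -> 'rV[R]_n) (Q : nat -> S -> 'rV[R]_m)
      (lambda : R) (T : nat) (k : 'I_m),
    compact X0 -> convex_set X0 ->
    iid_samples mu om ->
    constraint_functions X0 g gradg ->
    loss_functions X0 P om f gradf ->
    basic_assumption X0 D1 D2 G Rad g gradg gradf ->
    slater_assumption X0 eps mu g ->
    (forall w : S,
       algorithm1 X0 (Num.sqrt T%:R) T%:R
         (fun t j y => g j y (om t w)) (fun t j y => gradg j y (om t w))
         (fun t => gradf t w) (fun t => x t w) (fun t => Q t w)) ->
    (forall t, (1 <= t)%N ->
       measurable_wrt (history om t.-1) (x t) /\
       measurable_wrt (history om t.-1) (Q t)) ->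
    0 < lambda < 1 -> (1 <= T)%N ->
    (P [set w | (\sum_(1 <= t < T.+1) g k (x t w) (om t w) <= B T lambda)%R]
       >= (1 - lambda)%:E)%E.
Proof.
exists (violation_bound m D1 D2 G Rad eps); first exact: violation_bound_bigO.
move=> n X0 d S P d' Om mu om g gradg f gradf x Q lambda T k _ X0_convex
  samples constraints _ bounds [xh Xxh slater] alg adapted /andP[lambda0 _] T1.
exact: (constraint_violation_whp hD1 hD2 hG hRad heps X0_convex samples
  constraints bounds Xxh slater alg adapted T1 k lambda0).
Qed.
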